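(* Assume that $f,g$ satisfy the regularity condition and the dissipativity condition stated in the context. Let $R>0$, let $\xi\in B(R)$, and let $\lambda_1>0$ be a constant such that $b_{10}-\lambda_1-b_{11}e^{\lambda_1\tau}>0$ and $b_{12}-b_{13}e^{\lambda_1\tau}>0$. Then there exist $\Delta_1>0$ and a constant $C>0$ (depending on $\xi$ and $\lambda_1$, but not on the time index $k$) such that for every step size $\Delta=\tau/M\in(0,\Delta_1]$ the backward Euler-Maruyama approximation $\{X_k\}_{k\ge -M}$ with initial data $\xi$ satisfies $$\sup_{i\ge -M}\mathbb{E}\Big(|X_i|^2+\frac{l_2\Delta}{1+\lambda_1\Delta}\,|g(X_i,X_{i-M})|^2\Big)+\sup_{k\ge 0}\ \Delta\sum_{j=k-M+1}^{k}\mathbb{E}\big(|X_j|^{q+1}\big)\le C,$$ where for $-M\le i<0$ (when $X_{i-M}$ is not defined) the term containing $g$ is read as $0$.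
   Context: Setting. $|\cdot|$ is the Euclidean norm on $\mathbb{R}^d$ and the trace norm on $\mathbb{R}^{d\times m}$. Let $\tau>0$, $\mathcal{C}=C([-\tau,0];\mathbb{R}^d)$ with supremum norm $\|X\|=\sup_{-\tau\le\theta\le0}|X(\theta)|$, and $B(R)=\{X\in\mathcal{C}:\|X\|\le R\}$ for $R>0$. $W$ is an $m$-dimensional Brownian motion on a filtered probability space with the usual conditions. $f:\mathbb{R}^d\times\mathbb{R}^d\to\mathbb{R}^d$ and $g:\mathbb{R}^d\times\mathbb{R}^d\to\mathbb{R}^{d\times m}$ are Borel measurable, and the stochastic delay differential equation considered is $dx(t)=f(x(t),x(t-\tau))dt+g(x(t),x(t-\tau))dW(t)$, $t>0$, with initial data $x(\theta)=\xi(\theta)$, $\theta\in[-\tau,0]$. Regularity condition. There are constants $q\ge2$ and $a_1,\dots,a_9,\epsilon_1,\epsilon_2\ge0$, and functions $g_1,g_2:\mathbb{R}^d\to\mathbb{R}^{d\times m}$ such that, with $V(x,y)=|x-y|^2(|x|^{q-1}+|y|^{q-1})$, for all $x,\bar x,y,\bar y\in\mathbb{R}^d$: $|f(x,y)-f(\bar x,\bar y)|\le a_1(1+|x|^{q-1}+|\bar x|^{q-1}+|y|^{q-1}+|\bar y|^{q-1})(|x-\bar x|+|y-\bar y|)$; $|g(x,y)-g(\bar x,\bar y)|^2\le\epsilon_1|g_1(x)-g_1(\bar x)|^2+\epsilon_2|g_2(y)-g_2(\bar y)|^2$; $\epsilon_1|g_1(x)-g_1(\bar x)|^2\le a_2|x-\bar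 x|^2+a_4V(x,\bar x)$; $\epsilon_2|g_2(y)-g_2(\bar y)|^2\le a_3|y-\bar y|^2+a_5V(y,\bar y)$; $|f(x,y)|\le a_6(1+|x|^q+|y|^q)$; $|g(x,y)|^2\le a_7+a_8|x|^{q+1}+a_9|y|^{q+1}$. Dissipativity condition. With the same $q,a_i,V$ and $p^*=4q-2$, there are nonnegative constants $b_1,\dots,b_{13},l_1,l_2$ with $b_1>b_2+l_1(a_2+a_3)$, $b_3>l_1(a_4+a_5)$, $b_5>b_6$, $b_7>b_8$, $b_{10}>b_{11}$, $b_{12}>b_{13}$, $l_1>2$, $l_2>1$, such that for all $x,\bar x,y,\bar y\in\mathbb{R}^d$: $2\langle x-\bar x,f(x,y)-f(\bar x,\bar y)\rangle\le-b_1|x-\bar x|^2+b_2|y-\bar y|^2-b_3V(x,\bar x)$; $\frac{p^*}{2}|x|^{p^*-2}\big(2\langle x,f(x,y)\rangle+(p^*-1)|g(x,y)|^2\big)\le b_4-b_5|x|^{p^*}+b_6|y|^{p^*}-b_7|x|^{p^*+q-1}+b_8|y|^{p^*+q-1}$; $2\langle x,f(x,y)\rangle+l_2|g(x,y)|^2\le b_9-b_{10}|x|^2+b_{11}|y|^2-b_{12}|x|^{q+1}+b_{13}|y|^{q+1}$. Backward Euler-Maruyama (BEM) method. Step sizes are $\Delta=\tau/M$ with $M$ a positive integer, $t_k=k\Delta$ for $k\ge-M$. Put $X_k=\xi(t_k)$ for $k=-M,\dots,0$ and, for $k\ge1$, $X_k=X_{k-1}+f(X_k,X_{k-M})\Delta+g(X_{k-1},X_{k-M-1})\Delta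 W_{k-1}$, where $\Delta W_{k-1}=W(k\Delta)-W((k-1)\Delta)$ (this implicit scheme is well defined). *)

(* Defs.v *)
From HB Require Import structures.
From mathcomp Require Export all_boot all_order all_algebra.
From mathcomp Require Export all_classical all_reals all_analysis.
Export Order.TTheory GRing.Theory Num.Theory.
Export numFieldNormedType.Exports.

#[export] Set Implicit Arguments.
#[export] Unset Strict Implicit.
#[export] Unset Printing Implicit Defensive.

Local Open Scope classical_set_scope.
Local Open Scope ring_scope.

Definition borel (T : topologicalType) : set (set T) :=
  <<s [set U : set T | open U] >>.
Arguments borel : clear implicits.

Definition borel_measurable (T U : topologicalType) (h : T -> U) : Prop :=
  forall B, borel U B -> borel T (h @^-1` B).

(* For m = 1 this is the Euclidean norm on column vectors. *)
Definition trace_norm (R : realType) (d m : nat) (A : 'M[R]_(d, m)) : R :=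
  Num.sqrt (\tr (A^T *m A)).

Definition dotp (R : realType) (d : nat) (x y : 'cV[R]_d) : R :=
  \sum_(i < d) x i 0 * y i 0.

Definition sup_norm (R : realType) (d : nat) (tau : R) (xi : R -> 'cV[R]_d) : R :=
  sup [set trace_norm (xi th) | th in `[- tau, 0]].

(* The real-valued [sup] is meaningful here: the set is nonempty for
   [0 <= tau] and bounded for continuous [xi]. *)
Definition C_ball (R : realType) (d : nat) (tau r : R) : set (R -> 'cV[R]_d) :=
  [set xi | {within `[- tau, 0], continuous xi} /\ sup_norm tau xi <= r].
Arguments C_ball {R} d tau r.

Definition V (R : realType) (d : nat) (q : R) (x y : 'cV[R]_d) : R :=
  trace_norm (x - y) ^+ 2 *
  (trace_norm x `^ (q - 1) + trace_norm y `^ (q - 1)).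

(* The index set of the filtration is [0, +oo[; [F t] is irrelevant for t < 0.
   Completeness of P is a consequence of [usual_null] and [usual_sub]. *)
Record usual_filtration (R : realType) (disp : measure_display)
    (Omega : measurableType disp) (P : probability Omega R)
    (F : R -> set (set Omega)) : Prop := UsualFiltration {
  usual_sigma : forall t : R, 0 <= t -> sigma_algebra setT (F t) ;
  usual_sub : forall t : R, 0 <= t -> F t `<=` measurable ;
  usual_mono : forall s t : R, 0 <= s -> s <= t -> F s `<=` F t ;
  usual_right : forall t : R, 0 <= t -> F t = \bigcap_(s in [set s | t < s]) F s ;
  usual_null : forall N, P.-negligible N -> F 0 N }.

(* [normal_prob] takes the standard deviation as its second parameter. *)
Record brownian_motion (R : realType) (disp : measure_display)
    (Omega : measurableType disp) (P : probability Omega R)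
    (F : R -> set (set Omega)) (m : nat) (W : R -> Omega -> 'cV[R]_m)
    : Prop := BrownianMotion {
  bm_adapted : forall t : R, 0 <= t ->
    forall B, borel 'cV[R]_m B -> F t (W t @^-1` B) ;
  bm_start : {ae P, forall w, W 0 w = 0} ;
  bm_indep : forall s t : R, 0 <= s -> s < t ->
    forall A B, F s A -> borel 'cV[R]_m B ->
    P (A `&` (fun w => W t w - W s w) @^-1` B)
      = (P A * P ((fun w => W t w - W s w)%R @^-1` B))%E ;
  bm_normal : forall s t : R, 0 <= s -> s < t ->
    forall B : 'I_m -> set R, (forall i, measurable (B i)) ->
    P [set w | forall i, B i ((W t w - W s w) i 0)]
      = (\prod_(i < m) normal_prob 0 (Num.sqrt (t - s)%R) (B i))%E ;
  bm_continuous : {ae P, forall w, {within `[0, +oo[, continuous (W ^~ w)}} }.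

Record regularity_condition (R : realType) (d m : nat)
    (f : 'cV[R]_d -> 'cV[R]_d -> 'cV[R]_d)
    (g : 'cV[R]_d -> 'cV[R]_d -> 'M[R]_(d, m))
    (q a1 a2 a3 a4 a5 a6 a7 a8 a9 eps1 eps2 : R)
    (g1 g2 : 'cV[R]_d -> 'M[R]_(d, m)) : Prop := RegularityCondition {
  reg_q : 2 <= q ;
  reg_a : [/\ 0 <= a1, 0 <= a2, 0 <= a3, 0 <= a4 & 0 <= a5] /\
          [/\ 0 <= a6, 0 <= a7, 0 <= a8 & 0 <= a9] ;
  reg_eps : 0 <= eps1 /\ 0 <= eps2 ;
  reg_f_lip : forall x x' y y',
    trace_norm (f x y - f x' y') <=
      a1 * (1 + trace_norm x `^ (q - 1) + trace_norm x' `^ (q - 1)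
              + trace_norm y `^ (q - 1) + trace_norm y' `^ (q - 1))
         * (trace_norm (x - x') + trace_norm (y - y')) ;
  reg_g_lip : forall x x' y y',
    trace_norm (g x y - g x' y') ^+ 2 <=
      eps1 * trace_norm (g1 x - g1 x') ^+ 2
      + eps2 * trace_norm (g2 y - g2 y') ^+ 2 ;
  reg_g1 : forall x x',
    eps1 * trace_norm (g1 x - g1 x') ^+ 2 <=
      a2 * trace_norm (x - x') ^+ 2 + a4 * V q x x' ;
  reg_g2 : forall y y',
    eps2 * trace_norm (g2 y - g2 y') ^+ 2 <=
      a3 * trace_norm (y - y') ^+ 2 + a5 * V q y y' ;
  reg_f_growth : forall x y,
    trace_norm (f x y) <= a6 * (1 + trace_norm x `^ q + trace_norm y `^ q) ;
  reg_g_growth : forall x y,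
    trace_norm (g x y) ^+ 2 <=
      a7 + a8 * trace_norm x `^ (q + 1) + a9 * trace_norm y `^ (q + 1) }.

Record dissipativity_condition (R : realType) (d m : nat)
    (f : 'cV[R]_d -> 'cV[R]_d -> 'cV[R]_d)
    (g : 'cV[R]_d -> 'cV[R]_d -> 'M[R]_(d, m))
    (q a2 a3 a4 a5 b1 b2 b3 b4 b5 b6 b7 b8 b9 b10 b11 b12 b13 l1 l2 : R)
    : Prop := DissipativityCondition {
  dis_b : [/\ 0 <= b1, 0 <= b2, 0 <= b3, 0 <= b4 & 0 <= b5] /\
          [/\ 0 <= b6, 0 <= b7, 0 <= b8 & 0 <= b9] /\
          [/\ 0 <= b10, 0 <= b11, 0 <= b12 & 0 <= b13] ;
  dis_l : 0 <= l1 /\ 0 <= l2 ;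
  dis_b1 : b2 + l1 * (a2 + a3) < b1 ;
  dis_b3 : l1 * (a4 + a5) < b3 ;
  dis_b5 : b6 < b5 ;
  dis_b7 : b8 < b7 ;
  dis_b10 : b11 < b10 ;
  dis_b12 : b13 < b12 ;
  dis_l1 : 2 < l1 ;
  dis_l2 : 1 < l2 ;
  dis_mono : forall x x' y y',
    2 * dotp (x - x') (f x y - f x' y') <=
      - b1 * trace_norm (x - x') ^+ 2 + b2 * trace_norm (y - y') ^+ 2
      - b3 * V q x x' ;
  dis_pstar : let ps := 4 * q - 2 in forall x y,
    ps / 2 * trace_norm x `^ (ps - 2)
      * (2 * dotp x (f x y) + (ps - 1) * trace_norm (g x y) ^+ 2) <=
      b4 - b5 * trace_norm x `^ ps + b6 * trace_norm y `^ ps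
      - b7 * trace_norm x `^ (ps + q - 1) + b8 * trace_norm y `^ (ps + q - 1) ;
  dis_coercive : forall x y,
    2 * dotp x (f x y) + l2 * trace_norm (g x y) ^+ 2 <=
      b9 - b10 * trace_norm x ^+ 2 + b11 * trace_norm y ^+ 2
      - b12 * trace_norm x `^ (q + 1) + b13 * trace_norm y `^ (q + 1) }.

(* [X k] is irrelevant for k < -M.  Only the scheme is required of X: since
   x |-> x - Delta f(x, y) is injective under the dissipativity condition, the
   scheme determines X k for all k >= -M, hence also its adaptedness. *)
Record BEM (R : realType) (d m : nat) (Omega : Type)
    (f : 'cV[R]_d -> 'cV[R]_d -> 'cV[R]_d)
    (g : 'cV[R]_d -> 'cV[R]_d -> 'M[R]_(d, m))
    (W : R -> Omega -> 'cV[R]_m) (xi : R -> 'cV[R]_d)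
    (M : nat) (Delta : R) (X : int -> Omega -> 'cV[R]_d) : Prop := MkBEM {
  BEM_init : forall (k : int) w, - M%:Z <= k -> k <= 0 ->
    X k w = xi (k%:~R * Delta) ;
  BEM_step : forall (k : int) w, 1 <= k ->
    X k w = X (k - 1) w + Delta *: f (X k w) (X (k - M%:Z) w)
      + g (X (k - 1) w) (X (k - M%:Z - 1) w)
        *m (W (k%:~R * Delta) w - W ((k - 1)%:~R * Delta) w) }.

(* Main.v *)
Require Import Defs.
From mathcomp Require Import measurable_realfun ring lra zify.
Local Open Scope classical_set_scope.
Local Open Scope ring_scope.

(** The drift is evaluated at the new point, so the scheme reads
    [X_k - D f_k = X_(k-1) + g_(k-1) dW], where [f_k], [g_k] stand for the
    coefficients at [(X_k, X_(k-M))].  Squaring the left side and dropping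
    [D^2 |f_k|^2] leaves [|X_k|^2 - 2 D <X_k, f_k>], which the coercivity
    inequality bounds from below: this is the pathwise inequality
    [implicit_step_energy].  In mean the right side costs at most
    [E|X_(k-1)|^2 + D E|g_(k-1)|^2] ([vector_brownian_energy]), because the
    increment is centred, has independent coordinates of variance [D] and is
    independent of the past.  Since [l2 > 1], the term [l2 D E|g_k|^2] gained on
    the left pays for the term [D E|g_k|^2] lost at the next step: with
    [S = 1 + lambda1 D] and [H_k = E|X_k|^2 + (l2 D / S) E|g_k|^2], the sum
    [E|X_k|^2 + D E|g_k|^2] is at most [H_k] as soon as [S <= l2], and this is
    the only restriction on the step size.  One obtains

      [S H_k + (b10 - lambda1) D E|X_k|^2 + b12 D E|X_k|^(q+1)
         <= H_(k-1) + b9 D + b11 D E|X_(k-M)|^2 + b13 D E|X_(k-M)|^(q+1)].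

    Multiply by [S^(k-1)] and sum over [k].  Shifting the delayed sums by [M]
    costs a factor [S^M <= exp(lambda1 tau)], up to terms coming from the
    initial segment, so the two conditions on [lambda1] say exactly that the
    dissipative sums dominate the delayed ones.  What remains is
    [S^n H_n + c D (sum of S^j E|X_(j+1)|^(q+1) over j < n) <= K S^n] with [K]
    free of [n] and [D].  It bounds [H_n], and also the sum over a window of [M]
    steps, on which the weights [S^j] vary by a factor at most [exp(lambda1 tau)]
    ([delayed_gronwall_pointwise], [delayed_gronwall_window]).

    The probabilistic step needs [X_k] to be measurable for the past, while [X]
    is only known to solve the implicit equations.  The monotonicity inequality
    makes [X_k] a Lipschitz function of the pair formed by the explicit part
    [X_(k-1) + g_(k-1) dW] and the delayed value [X_(k-M)], on whichever pairs
    occur ([implicit_step_stable]).  A function which is continuous in finitely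
    many measurable coordinates is measurable ([measurable_initially_open]). *)

(** * Functions determined by finitely many measurable coordinates *)

(** The boxes with rational centre and radius [1/(n+1)] in the coordinates [h]
    are countably many, and an open set is the union of those it contains.
    Openness is required only at points of the range of [h], so that the lemma
    applies to functions of [h] that have no extension to the whole space. *)
Lemma measurable_initially_open d (T : measurableType d) (R : realType)
    (I : finType) (h : I -> T -> R) (A : set T) :
  (forall i, measurable_fun setT (h i)) ->
  (forall w, A w -> exists2 e : R, 0 < e &
     forall w', (forall i, `|h i w' - h i w| < e) -> A w') ->
  measurable A.
Proof.
move=> mh Aopen.
pose box (p : {ffun I -> rat} * nat) : set T :=
  \bigcap_(i in [set: I]) [set w | `|h i w - ratr (p.1 i)| < p.2.+1%:R^-1].
have mbox p : measurable (box p).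
  apply: fin_bigcap_measurable => // i _.
  rewrite (_ : [set w | _] = setT `&`
    (fun w => `|h i w - ratr (p.1 i)|) @^-1` `]-oo, p.2.+1%:R^-1[); last first.
    by rewrite setTI; apply/seteqP; split=> w /=; rewrite in_itv.
  apply: (_ : measurable_fun setT _) => //.
  by apply: measurableT_comp => //; exact: measurable_funB.
have -> : A = \bigcup_(p in setT) (if pselect (box p `<=` A) then box p else set0).
  apply/seteqP; split=> [w Aw|w [p _]]; last first.
    by case: pselect => // boxA /boxA.
  have [e e0 nearA] := Aopen _ Aw.
  have [n /= ne] : exists n, n.+1%:R^-1 < e / 2 :> R.
    have e20 : 0 < e / 2 by rewrite divr_gt0.
    exists (Num.truncn (e / 2)^-1); rewrite invf_plt ?posrE//.
    exact: truncnS_gt.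
  have rat_near (i : I) : exists c : rat, `|h i w - ratr c| < n.+1%:R^-1.
    have : h i w - n.+1%:R^-1 < h i w + n.+1%:R^-1.
      by rewrite ltrD2l gtrN ?invr_gt0.
    move=> /rat_in_itvoo[c]; rewrite in_itv /= => /andP[lo hi]; exists c.
    by rewrite distrC ltr_norml ltrBrDl lo ltrBlDl hi.
  pose c := [ffun i => xget 0 [set c : rat | `|h i w - ratr c| < n.+1%:R^-1]].
  have cP i : `|h i w - ratr (c i)| < n.+1%:R^-1.
    by rewrite ffunE; case: xgetP => [? _ //|]; have [r hr] := rat_near i => /(_ r).
  exists (c, n) => //; case: pselect => [_ i _ /=|nboxA]; first exact: cP.
  exfalso; apply: nboxA => w' bw'; apply: nearA => i.
  rewrite [X in `|X|](_ : _ = (h i w' - ratr (c i)) - (h i w - ratr (c i))).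
    rewrite (le_lt_trans (ler_normB _ _))//.
    rewrite (splitr e) ltrD// ?(lt_trans (bw' i _) ne)//.
    exact: (lt_trans (cP i) ne).
  by rewrite opprB addrA subrK.
apply: countable_bigcupT_measurable => // p.
by case: (pselect (box p `<=` A)) => boxA; [exact: mbox|exact: measurable0].
Qed.

(** * Finite means and products of independent variables *)

Section finite_mean.
Context d (T : measurableType d) (R : realType) (P : probability T R).

Definition finite_mean (h : T -> R) : Prop := P.-integrable setT (EFin \o h).

Lemma finite_mean_cst (c : R) : finite_mean (fun=> c).
Proof. exact: finite_measure_integrable_cst. Qed.

Lemma mean_cst (c : R) : (\int[P]_w c)%R = c.
Proof.
rewrite Rintegral_cst// -[RHS]mulr1; congr (_ * _).
by rewrite -[RHS]/(fine 1%:E); congr fine; exact: probability_setT.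
Qed.

Lemma finite_meanD (h h' : T -> R) : finite_mean h -> finite_mean h' ->
  finite_mean (fun w => h w + h' w).
Proof. by move=> ih ih'; exact: (integrableD measurableT ih ih'). Qed.

Lemma finite_meanZ (c : R) (h : T -> R) : finite_mean h -> finite_mean (fun w => c * h w).
Proof. by move=> ih; exact: (integrableZl measurableT c ih). Qed.

Lemma finite_meanE (h : T -> R) : finite_mean h ->
  (\int[P]_w (h w)%:E)%E = ((\int[P]_w h w)%R)%:E.
Proof. by move=> ih; rewrite /Rintegral fineK//; exact: integrable_fin_num. Qed.

Lemma mean_comb3 (c1 c2 c3 : R) (h1 h2 h3 : T -> R) :
  finite_mean h1 -> finite_mean h2 -> finite_mean h3 ->
  finite_mean (fun w => c1 * h1 w + c2 * h2 w + c3 * h3 w) /\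
  (\int[P]_w (c1 * h1 w + c2 * h2 w + c3 * h3 w))%R =
    c1 * (\int[P]_w h1 w)%R + c2 * (\int[P]_w h2 w)%R + c3 * (\int[P]_w h3 w)%R.
Proof.
move=> i1 i2 i3.
have [[j1 j2] j3] := (finite_meanZ c1 i1, finite_meanZ c2 i2, finite_meanZ c3 i3).
have j12 := finite_meanD j1 j2.
split; first exact: finite_meanD.
rewrite (RintegralD measurableT j12 j3) (RintegralD measurableT j1 j2).
by rewrite (RintegralZl _ measurableT i1) (RintegralZl _ measurableT i2) (RintegralZl _ measurableT i3).
Qed.

End finite_mean.

(** The product rule is asked on Borel events only, which determines the joint
    law because rectangles generate the product sigma-algebra. *)
Definition independent_fun d (T : measurableType d) (R : realType)
    (P : probability T R) (U V : T -> R) : Prop :=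
  forall A B : set R, measurable A -> measurable B ->
    P (U @^-1` A `&` V @^-1` B) = (P (U @^-1` A) * P (V @^-1` B))%E.

Section independent_product.
Context d (T : measurableType d) (R : realType) (P : probability T R).
Variables (U V : T -> R).
Hypotheses (iU : P.-integrable setT (EFin \o U))
  (iV : P.-integrable setT (EFin \o V)) (UV : independent_fun P U V).

Let mU : measurable_fun setT U.
Proof. exact/measurable_EFinP/(measurable_int P). Qed.
Let mV : measurable_fun setT V.
Proof. exact/measurable_EFinP/(measurable_int P). Qed.
Let rU : {RV P >-> R} := mfun_Sub (mem_set mU).
Let rV : {RV P >-> R} := mfun_Sub (mem_set mV).
Let mUV : measurable_fun setT (fun w => (U w, V w)).
Proof. exact: measurable_fun_pair. Qed.
Let rUV : {mfun T >-> (R * R)%type} := mfun_Sub (mem_set mUV).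

Let joint_law A : measurable A ->
  (distribution P rU \x distribution P rV)%E A = distribution P rUV A.
Proof. exact: product_measure_unique. Qed.

Let mprod : measurable_fun setT (fun z : R * R => (z.1 * z.2)%:E).
Proof. by apply/measurable_EFinP; exact: measurable_funM. Qed.

Let mnorm : measurable_fun setT (fun x : R => `|x|%:E).
Proof. by apply/measurable_EFinP; exact: normr_measurable. Qed.

Let integral_abs (W : T -> R) (rW : {RV P >-> R}) : rW = W :> (T -> R) ->
  P.-integrable setT (EFin \o W) ->
  exists2 c : R, 0 <= c & (\int[distribution P rW]_x `|x|%:E = c%:E)%E.
Proof.
move=> <- /integrableP[_ fW].
exists (fine (\int[P]_w `|rW w|%:E)%E).
  by apply/fine_ge0/integral_ge0 => w _; rewrite lee_fin.
rewrite fineK; last by rewrite ge0_fin_numE//; apply: integral_ge0 => w _; rewrite lee_fin.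
by rewrite ge0_integral_distribution.
Qed.

Let iprod : (distribution P rU \x distribution P rV)%E.-integrable setT
  (fun z => (z.1 * z.2)%:E).
Proof.
apply/integrable12ltyP => //.
have [a _ aE] := integral_abs (rW := rU) erefl iU.
have [b b0 bE] := integral_abs (rW := rV) erefl iV.
rewrite [ltLHS](_ : _ = (\int[distribution P rU]_x (`|x|%:E * b%:E))%E).
  rewrite ge0_integralZr//.
  by rewrite aE -EFinM ltry.
apply: eq_integral => x _ /=.
under eq_integral do rewrite normrM EFinM.
by rewrite ge0_integralZl// bE.
Qed.

(** The joint law is the product of the marginal laws, so Tonelli's theorem
    reduces the integral of [|U V|] to a product of first absolute moments. *)
Lemma integrable_independent_prod :
  P.-integrable setT (EFin \o (fun w => U w * V w)).
Proof.
have /integrableP[m1 lty] := iprod.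
apply/integrableP; split; first by apply/measurable_EFinP; exact: measurable_funM.
move: lty; rewrite (eq_measure_integral (distribution P rUV)); last first.
  by move=> A mA _; exact: joint_law.
rewrite ge0_integral_distribution//.
by apply/measurableT_comp => //.
Qed.

Lemma integral_independent_prod :
  (\int[P]_w (U w * V w)%:E = (\int[P]_w (U w)%:E) * (\int[P]_w (V w)%:E))%E.
Proof.
have idU : P.-integrable setT (EFin \o rU) by exact: iU.
have idV : P.-integrable setT (EFin \o rV) by exact: iV.
have mid : measurable_fun setT (fun x : R => x%:E) by apply/measurable_EFinP.
have EU : (\int[distribution P rU]_x x%:E = \int[P]_w (U w)%:E)%E.
  by rewrite integral_distribution.
have EV : (\int[distribution P rV]_x x%:E = \int[P]_w (V w)%:E)%E.
  by rewrite integral_distribution.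
have fV : (\int[P]_w (V w)%:E)%E \is a fin_num by exact: integrable_fin_num.
transitivity (\int[distribution P rUV]_z (z.1 * z.2)%:E)%E.
  by rewrite integral_distribution//; exact: integrable_independent_prod.
transitivity (\int[distribution P rU \x distribution P rV]_z (z.1 * z.2)%:E)%E.
  by apply: eq_measure_integral => A mA _; exact/esym/joint_law.
rewrite -(integral12_prod_meas1 iprod) /fubini_F /=.
under eq_integral => x _.
  under eq_integral do rewrite EFinM.
  rewrite integralZl//; last first.
    by apply: integrable_pushforward => //; exact: idV.
  rewrite EV -(fineK fV).
  over.
rewrite integralZr//; last by apply: integrable_pushforward => //; exact: idU.
by rewrite fineK// EU.
Qed.

End independent_product.

(** * Gaussian moments *)

Section gaussian_moments.
Context (R : realType).
Variable s : R.
Hypothesis s_gt0 : 0 < s.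
Local Notation mu := (@lebesgue_measure R).
Local Notation phi := (normal_pdf 0 s).

Let s0 : s != 0. Proof. by rewrite gt_eqF. Qed.

Let phiE : phi = fun x => normal_peak s * expR (- x ^+ 2 / (s ^+ 2 *+ 2)).
Proof.
by apply/funext => x; rewrite normal_pdfE// /normal_fun subr0.
Qed.

Lemma normal_pdfN x : phi (- x) = phi x.
Proof. by rewrite phiE sqrrN. Qed.

Lemma is_derive_normal_pdf (x : R) : is_derive x 1 phi (- x / s ^+ 2 * phi x).
Proof.
rewrite phiE; apply: is_derive_eq.
rewrite !scaler0 add0r /GRing.scale /=.
by field.
Qed.

(** A primitive of [(x^2 - s^2) phi x]. *)
Let mom (x : R) := - s ^+ 2 * (x * phi x).

Let is_derive_mom (x : R) : is_derive x 1 mom ((x ^+ 2 - s ^+ 2) * phi x).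
Proof.
have dphi := is_derive_normal_pdf x.
apply: is_derive_eq.
rewrite /GRing.scale /=; field.
exact: s0.
Qed.

Let cphi : continuous phi. Proof. exact: continuous_normal_pdf. Qed.

Let cmom : continuous mom.
Proof.
move=> x; apply: differentiable_continuous; apply/derivable1_diffP.
by have [] := is_derive_mom x.
Qed.

Let csq : continuous (fun x : R => x ^+ 2 * phi x).
Proof.
move=> x; apply: cvgM; last exact: cphi.
exact: exprn_continuous.
Qed.

Let cdmom : continuous (fun x : R => (x ^+ 2 - s ^+ 2) * phi x).
Proof.
move=> x; apply: cvgM; last exact: cphi.
by apply: cvgB; [exact: exprn_continuous|exact: cvg_cst].
Qed.

(** On a symmetric interval [(x^2 - s^2) phi] integrates to the negative number
    [- 2 s^2 a phi(a)]; so the truncated second moments increase to a limit that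
    is at most [s^2].  Upper bounds suffice for an energy estimate. *)
Let second_moment_itv (n : nat) :
  (\int[mu]_(x in `[(- n.+1%:R)%R, n.+1%:R]) (x ^+ 2 * phi x)%:E <= (s ^+ 2)%:E)%E.
Proof.
set a := n.+1%:R : R.
have a0 : 0 < a by rewrite ltr0n.
have aNa : - a < a by lra.
have iphi : mu.-integrable `[(- a), a] (fun x => (s ^+ 2)%:E * (phi x)%:E)%E.
  apply: integrableZl => //; apply: (integrableS _ _ (@subsetT _ _)) => //.
  exact: integrable_normal_pdf.
have := @continuous_FTC2 _ (fun x => (x ^+ 2 - s ^+ 2) * phi x) mom _ _ aNa.
move=> /(_ _ _ _)H.
have {}H : (\int[mu]_(x in `[(- a)%R, a]) ((x ^+ 2 - s ^+ 2) * phi x)%:E <= 0)%E.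
  rewrite H.
  - rewrite /mom -EFinB lee_fin normal_pdfN.
    suff : 0 <= s ^+ 2 * (a * phi a) by lra.
    by apply: mulr_ge0; [exact: sqr_ge0|apply: mulr_ge0; [exact: ltW|exact: normal_pdf_ge0]].
  - exact: continuous_subspaceT.
  - split.
    + by move=> x _; have [] := is_derive_mom x.
    + by apply: cvg_at_right_filter; exact: cmom.
    + by apply: cvg_at_left_filter; exact: cmom.
  - by move=> x _; rewrite derive1E; have [_ ->] := is_derive_mom x.
have -> : (\int[mu]_(x in `[(- a)%R, a]) (x ^+ 2 * phi x)%:E =
    \int[mu]_(x in `[(- a)%R, a]) (((x ^+ 2 - s ^+ 2) * phi x)%:E
     + (s ^+ 2)%:E * (phi x)%:E))%E.
  apply: eq_integral => x _; rewrite -EFinM -EFinD; congr EFin; ring.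
rewrite integralD//; last first.
  apply: continuous_compact_integrable; first exact: segment_compact.
  exact: continuous_subspaceT.
rewrite -[leRHS]add0e leeD// integralZl//; last first.
  apply: (integrableS _ _ (@subsetT _ _)) => //; exact: integrable_normal_pdf.
rewrite -[leRHS]mule1 lee_pmul2l ?lte_fin ?exprn_gt0//.
rewrite -(integral_normal_pdf 0 s); apply: ge0_subset_integral => //.
- by apply/measurable_EFinP; exact: measurable_normal_pdf.
- by move=> x _; rewrite lee_fin normal_pdf_ge0.
Qed.

Lemma integral_sqr_normal_pdf :
  (\int[mu]_x (x ^+ 2 * phi x)%:E <= (s ^+ 2)%:E)%E.
Proof.
have msq : measurable_fun setT (fun x : R => (x ^+ 2 * phi x)%:E).
  by apply/measurable_EFinP; exact: continuous_measurable_fun.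
have -> : [set: R] = \bigcup_n `[(- n.+1%:R)%R, n.+1%:R]%classic.
  apply/seteqP; split=> // x _; exists (Num.truncn `|x|) => //=.
  by rewrite in_itv /= -ler_norml ltW// truncnS_gt.
apply: (cvge_le _ (ge0_nondecreasing_set_cvg_integral _ _ _ _)) => /=.
- by near=> n; exact: second_moment_itv.
- apply/nondecreasing_seqP => n; rewrite subsetEset => x /=.
  rewrite !in_itv /= => /andP[lo hi].
  have nn : n.+1%:R <= n.+2%:R :> R by rewrite ler_nat.
  by rewrite (le_trans hi nn) andbT (le_trans _ lo)// lerN2.
- by move=> n; exact: measurable_itv.
- by move=> n; exact: measurable_funTS.
- by move=> n x _; rewrite lee_fin mulr_ge0 ?sqr_ge0 ?normal_pdf_ge0.
Unshelve. all: by end_near.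
Qed.

(** The normal density is a Radon-Nikodym derivative of the normal law. *)
Lemma ge0_integral_normal_prob (f : R -> \bar R) :
  measurable_fun setT f -> (forall x, 0 <= f x)%E ->
  (\int[normal_prob 0 s]_x f x = \int[mu]_x (f x * (phi x)%:E))%E.
Proof.
move=> mf f0; have dom := normal_prob_dominates 0 s.
rewrite -(Radon_Nikodym_SigmaFinite.change_of_variables dom)//.
apply: ae_eq_integral => //.
- apply: emeasurable_funM => //; apply: (measurable_int mu).
  exact: Radon_Nikodym_SigmaFinite.f_integrable.
- by apply: emeasurable_funM => //; apply/measurable_EFinP; exact: measurable_normal_pdf.
- apply: ae_eqe_mul2l; apply: integral_ae_eq => //.
  + exact: Radon_Nikodym_SigmaFinite.f_integrable.
  + by apply/measurable_EFinP; exact: measurable_normal_pdf.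
  + by move=> E _ mE; rewrite -Radon_Nikodym_SigmaFinite.f_integral.
Qed.

Lemma normal_prob_sqr :
  (\int[normal_prob 0 s]_x (x ^+ 2)%:E <= (s ^+ 2)%:E)%E.
Proof.
rewrite ge0_integral_normal_prob//; first exact: integral_sqr_normal_pdf.
by apply/measurable_EFinP; exact: measurable_funX.
by move=> x; rewrite lee_fin sqr_ge0.
Qed.

Lemma normal_probN (A : set R) : measurable A ->
  normal_prob 0 s (-%R @^-1` A) = normal_prob 0 s A.
Proof.
move=> mA; rewrite /normal_prob.
have mphi : measurable_fun setT (fun x : R => (phi x)%:E).
  by apply/measurable_EFinP; exact: measurable_normal_pdf.
transitivity (\int[pushforward mu (-%R : R -> measurableTypeR R)]_(x in A) (phi x)%:E)%E.
  rewrite ge0_integral_pushforward//.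
  - by apply: eq_integral => x _ /=; rewrite normal_pdfN.
  - exact: measurable_funTS.
  - by move=> x _; rewrite lee_fin normal_pdf_ge0.
apply: eq_measure_integral => B mB _; exact: lebesgue_measureN.
Qed.

Lemma normal_prob_mean : (\int[normal_prob 0 s]_x x%:E = 0)%E.
Proof.
have i1 : (normal_prob 0 s).-integrable setT (fun x : R => x%:E).
  apply/integrableP; split; first exact/measurable_EFinP.
  apply: (@le_lt_trans _ _ (\int[normal_prob 0 s]_x (1 + x ^+ 2)%:E)%E).
    apply: ge0_le_integral => //.
    + by apply/measurable_EFinP; exact: normr_measurable.
    + by apply/measurable_EFinP; apply: measurable_funD => //; exact: measurable_funX.
    + move=> x _; rewrite lee_fin.
      by have := sqr_ge0 (`|x| - 1); rewrite -(real_normK (num_real x)); nra.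
  under eq_integral do rewrite EFinD.
  rewrite ge0_integralD//.
  - rewrite integral_cst// mul1e; apply: lte_add_pinfty.
      exact: (le_lt_trans (@probability_le1 _ _ _ (normal_prob 0 s) _ measurableT) (ltry _)).
    exact: (le_lt_trans normal_prob_sqr (ltry _)).
  - by move=> x _; rewrite lee_fin sqr_ge0.
  - by apply/measurable_EFinP; exact: measurable_funX.
have iN : (normal_prob 0 s).-integrable setT (fun x : R => (- x)%:E).
  exact: (integrableN i1).
have E : (\int[normal_prob 0 s]_x x%:E = - \int[normal_prob 0 s]_x x%:E)%E.
  rewrite -integralN.
  - transitivity (\int[pushforward (normal_prob 0 s) (-%R : R -> measurableTypeR R)]_x x%:E)%E.
      by apply: eq_measure_integral => B mB _; apply/esym/normal_probN.
    by rewrite integral_pushforward//.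
  - exact: integrable_add_def.
have fin : (\int[normal_prob 0 s]_x x%:E)%E \is a fin_num by exact: integrable_fin_num.
move: E; rewrite -(fineK fin) -EFinN => -[E].
by congr EFin; lra.
Qed.

End gaussian_moments.

(** * Uncorrelated sums *)

Section square_integrable.
Context d (T : measurableType d) (R : realType) (P : probability T R).

Definition square_integrable (U : T -> R) : Prop :=
  measurable_fun setT U /\ (\int[P]_w (U w ^+ 2)%:E < +oo)%E.

Lemma square_integrable_cst (c : R) : square_integrable (fun=> c).
Proof.
split; first exact: measurable_cst.
rewrite integral_cst//; apply: lte_mul_pinfty; rewrite ?lee_fin ?sqr_ge0//.
exact: (le_lt_trans (probability_le1 P measurableT) (ltry 1)).
Qed.

Lemma square_integrableP (U : T -> R) : square_integrable U ->
  P.-integrable setT (fun w => (U w ^+ 2)%:E).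
Proof.
move=> [mU U2]; apply/integrableP; split.
  by apply/measurable_EFinP; exact: measurable_funX.
under eq_integral do rewrite gee0_abs ?lee_fin ?sqr_ge0//.
exact: U2.
Qed.

Lemma square_integrable_mul (U V : T -> R) : square_integrable U ->
  square_integrable V -> P.-integrable setT (EFin \o (fun w => U w * V w)).
Proof.
move=> sU sV; have [[mU _] [mV _]] := (sU, sV).
apply: (le_integrable _ _ _
  (integrableD measurableT (square_integrableP sU) (square_integrableP sV))) => //.
  by apply/measurable_EFinP; exact: measurable_funM.
move=> w _; rewrite /= lee_fin [leRHS]ger0_norm ?addr_ge0 ?sqr_ge0//.
rewrite ler_norml; apply/andP; split.
- by have := sqr_ge0 (U w + V w); have := sqr_ge0 (U w); have := sqr_ge0 (V w); nra.
- by have := sqr_ge0 (U w - V w); have := sqr_ge0 (U w); have := sqr_ge0 (V w); nra.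
Qed.

(** Expand the square: independence splits each term as a product of means, and
    the off-diagonal ones vanish because the [w j] are orthogonal. *)
Lemma square_integral_uncorrelated (J : finType) (U w : J -> T -> R) (c : J -> R) :
  (forall j, square_integrable (U j)) -> (forall j, square_integrable (w j)) ->
  (forall i j, independent_fun P (fun x => U i x * U j x) (fun x => w i x * w j x)) ->
  (forall i j, i != j -> \int[P]_x (w i x * w j x)%:E = 0)%E ->
  (forall j, \int[P]_x (w j x ^+ 2)%:E <= (c j)%:E)%E ->
  (\int[P]_x ((\sum_j U j x * w j x) ^+ 2)%:E
     <= \sum_j (\int[P]_x (U j x ^+ 2)%:E) * (c j)%:E)%E.
Proof.
move=> sU sw ind w0 wc.
pose f (i j : J) x := ((U i x * U j x) * (w i x * w j x))%:E.
have iU i j := square_integrable_mul (sU i) (sU j).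
have iw i j := square_integrable_mul (sw i) (sw j).
have fi i j : P.-integrable setT (f i j).
  exact: (integrable_independent_prod (iU i j) (iw i j) (ind i j)).
have fE i j : (\int[P]_x f i j x = (\int[P]_x (U i x * U j x)%:E) * (\int[P]_x (w i x * w j x)%:E))%E.
  exact: integral_independent_prod.
have -> : (\int[P]_x ((\sum_j U j x * w j x) ^+ 2)%:E =
           \int[P]_x (\sum_i \sum_j f i j x))%E.
  apply: eq_integral => x _; rewrite expr2 mulr_suml.
  rewrite -sumEFin; apply: eq_bigr => i _.
  rewrite mulr_sumr -sumEFin; apply: eq_bigr => j _.
  by rewrite /f mulrACA.
rewrite integral_sum//; last by move=> i; exact: integrable_sum.
apply: lee_sum => i _; rewrite integral_sum// (bigD1 i)//= big1 ?adde0; last first.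
  by move=> j ji; rewrite fE w0 ?mule0// eq_sym.
rewrite fE; apply: lee_pmul => //.
- by apply: integral_ge0 => x _; rewrite lee_fin -expr2 sqr_ge0.
- by apply: integral_ge0 => x _; rewrite lee_fin -expr2 sqr_ge0.
- by exact: wc.
Qed.

(** Means of functions of [Z] are integrals against its law. *)
Lemma gaussian_square_integrable (s : R) (Z : T -> R) : 0 < s ->
  measurable_fun setT Z ->
  (forall B, measurable B -> P (Z @^-1` B) = normal_prob 0 s B) ->
  [/\ square_integrable Z, (\int[P]_x (Z x)%:E = 0)%E &
      (\int[P]_x (Z x ^+ 2)%:E <= (s ^+ 2)%:E)%E].
Proof.
move=> s0 mZ ZN.
have mZ' : measurable_fun setT (Z : T -> measurableTypeR R) by exact: mZ.
pose rZ := @MeasurableFun.Pack _ _ T (measurableTypeR R) Z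
  (MeasurableFun.Class (isMeasurableFun.Build _ _ T (measurableTypeR R) Z mZ')).
have law (f : R -> \bar R) : (\int[distribution P rZ]_x f x = \int[normal_prob 0 s]_x f x)%E.
  by apply: eq_measure_integral => A mA _; exact: ZN.
have Z2 : (\int[P]_x (Z x ^+ 2)%:E <= (s ^+ 2)%:E)%E.
  apply: le_trans (normal_prob_sqr s0).
  rewrite -law ge0_integral_distribution//.
    by apply/measurable_EFinP; exact: measurable_funX.
  by move=> x; rewrite lee_fin sqr_ge0.
have sZ : square_integrable Z.
  by split=> //; exact: (le_lt_trans Z2 (ltry _)).
split => //.
rewrite -(normal_prob_mean s0) -law integral_distribution//.
have := square_integrable_mul sZ (square_integrable_cst 1).
by apply: eq_integrable => // x _ /=; rewrite mulr1.
Qed.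

End square_integrable.

(** * Brownian increments *)

(** Turns measurability for a level of the filtration into the event-wise form in
    which adaptedness and independence of the Brownian motion are given. *)
Lemma measurable_wrtP (T : pointedType) (R : realType) (G : set (set T))
    (U : T -> R) : sigma_algebra setT G ->
  measurable_fun [set: g_sigma_algebraType G] U <->
  (forall B : set R, measurable B -> G (U @^-1` B)).
Proof.
move=> sG; split=> [mU B mB|mU _ B mB].
  rewrite -[G](measurable_g_measurableTypeE sG) -[_ @^-1` _]setTI.
  exact: mU.
by rewrite setTI measurable_g_measurableTypeE//; exact: mU.
Qed.

Lemma borel_measurable_coord (R : realType) d m (i : 'I_d) (j : 'I_m) :
  measurable_fun [set: g_sigma_algebraType [set U : set 'M[R]_(d, m) | open U]]
    (fun v : 'M[R]_(d, m) => v i j).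
Proof.
apply: (measurability _ (RGenOpens.measurableE R)) => _ [B [a [b ->]] <-].
rewrite setTI; apply: sub_sigma_algebra => /=.
apply: open_comp; last exact: interval_open.
by move=> v _; exact: coord_continuous.
Qed.

Lemma big_option (A : Type) (idx : A) (op : Monoid.com_law idx) (I : finType)
    (f : option I -> A) :
  \big[op/idx]_j f j = op (f None) (\big[op/idx]_i f (Some i)).
Proof.
rewrite (bigD1 None)//=; congr (op _ _).
rewrite (reindex_omap Some id)//=; last by case.
by apply: eq_bigl => i; rewrite eqxx.
Qed.

Section brownian_increment.
Context (R : realType) (disp : measure_display) (Omega : measurableType disp)
  (P : probability Omega R) (F : R -> set (set Omega)) (m : nat)
  (W : R -> Omega -> 'cV[R]_m).
Hypotheses (F_usual : usual_filtration P F) (W_bm : brownian_motion P F W).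
Variables (s t : R).
Hypotheses (s_ge0 : 0 <= s) (s_lt_t : s < t).
Local Notation dW := (fun w => W t w - W s w).

Let t_ge0 : 0 <= t. Proof. exact: le_trans (ltW s_lt_t). Qed.

Lemma adapted_measurable (u : R) (U : Omega -> R) : 0 <= u ->
  measurable_fun [set: g_sigma_algebraType (F u)] U -> measurable_fun setT U.
Proof.
move=> u0 /(measurable_wrtP _ (usual_sigma F_usual u0)) mU _ B mB.
by rewrite setTI; apply: (usual_sub F_usual u0); exact: mU.
Qed.

Lemma adapted_le (u v : R) (U : Omega -> R) : 0 <= u -> u <= v ->
  measurable_fun [set: g_sigma_algebraType (F u)] U ->
  measurable_fun [set: g_sigma_algebraType (F v)] U.
Proof.
move=> u0 uv; have v0 := le_trans u0 uv.
move=> /(measurable_wrtP _ (usual_sigma F_usual u0)) mU.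
apply/(measurable_wrtP _ (usual_sigma F_usual v0)) => B mB.
by apply: (usual_mono F_usual u0 uv); exact: mU.
Qed.

Lemma brownian_adapted (u : R) (i : 'I_m) : 0 <= u ->
  measurable_fun [set: g_sigma_algebraType (F u)] (fun w => W u w i 0).
Proof.
move=> u0; apply/(measurable_wrtP _ (usual_sigma F_usual u0)) => B mB.
apply: (bm_adapted W_bm u0 (B := (fun v : 'cV[R]_m => v i 0) @^-1` B)).
by rewrite -[_ @^-1` _]setTI; exact: borel_measurable_coord.
Qed.

Lemma measurable_increment (i : 'I_m) : measurable_fun setT (fun w => dW w i 0).
Proof.
rewrite (_ : (fun w => _) = (fun w => W t w i 0) \- (fun w => W s w i 0)); last first.
  by apply/funext => w; rewrite /= !mxE.
by apply: measurable_funB; apply: (adapted_measurable (u := _)) (brownian_adapted _ _).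
Qed.

(** Leave all coordinates but one unconstrained in the joint law of the
    increment; likewise with two coordinates below. *)
Lemma increment_law (i : 'I_m) (B : set R) : measurable B ->
  P ((fun w => dW w i 0) @^-1` B) = normal_prob 0 (Num.sqrt (t - s)) B.
Proof.
move=> mB; pose Bs k := if k == i then B else setT.
have Bsi : Bs i = B by rewrite /Bs eqxx.
have := bm_normal W_bm s_ge0 s_lt_t (B := Bs).
rewrite (bigD1 i)//= Bsi big1 ?mule1; last first.
  by move=> k ki; rewrite /Bs (negbTE ki); exact: probability_setT.
move=> <-; last by move=> k; rewrite /Bs; case: ifP.
congr (P _); apply/seteqP; split=> [w Bw k|w /(_ i)].
  by rewrite /Bs; case: eqP => // ->.
by rewrite Bsi.
Qed.

Lemma increment_coord_independent (i j : 'I_m) : i != j ->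
  independent_fun P (fun w => dW w i 0) (fun w => dW w j 0).
Proof.
move=> ij A B mA mB; rewrite !increment_law//.
pose Bs k := if k == i then A else if k == j then B else setT.
have Bsi : Bs i = A by rewrite /Bs eqxx.
have Bsj : Bs j = B by rewrite /Bs eq_sym (negbTE ij) eqxx.
have := bm_normal W_bm s_ge0 s_lt_t (B := Bs).
rewrite (bigD1 i)//= (bigD1 j) 1?eq_sym//= Bsi Bsj big1 ?mule1; last first.
  by move=> k /andP[ki kj]; rewrite /Bs (negbTE ki) (negbTE kj); exact: probability_setT.
move=> <-; last by move=> k; rewrite /Bs; do 2 case: ifP => //.
congr (P _); apply/seteqP; split=> [w [Aw Bw] k|w wBs].
  by rewrite /Bs; case: eqP => [->|_]//; case: eqP => [->|_].
by have := wBs i; have := wBs j; rewrite Bsi Bsj.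
Qed.

(** The constant 1 joins the coordinates of the increment as index [None]: the
    family remains orthogonal because these are centred. *)
Let wt (j : option 'I_m) (w : Omega) : R := if j is Some i then dW w i 0 else 1.

Let sqrt_gt0 : 0 < Num.sqrt (t - s). Proof. by rewrite sqrtr_gt0 subr_gt0. Qed.

Lemma increment_moments (i : 'I_m) :
  [/\ square_integrable P (fun w => dW w i 0),
      (\int[P]_w (dW w i 0)%:E = 0)%E &
      (\int[P]_w ((dW w i 0) ^+ 2)%:E <= (t - s)%:E)%E].
Proof.
have := gaussian_square_integrable sqrt_gt0 (measurable_increment i) (@increment_law i).
by rewrite sqr_sqrtr// subr_ge0 ltW.
Qed.

Lemma increment_independent (U : Omega -> R) (h : 'cV[R]_m -> R) :
  measurable_fun [set: g_sigma_algebraType (F s)] U ->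
  measurable_fun [set: g_sigma_algebraType [set V : set 'cV[R]_m | open V]] h ->
  independent_fun P U (fun w => h (dW w)).
Proof.
move=> /(measurable_wrtP _ (usual_sigma F_usual s_ge0)) mU mh A B mA mB.
rewrite (_ : (fun w => h (dW w)) @^-1` B = dW @^-1` (h @^-1` B))//.
apply: (bm_indep W_bm) => //; first exact: mU.
by rewrite -[_ @^-1` _]setTI; exact: mh.
Qed.

(** Orthogonality of 1 and the coordinates of the increment, with coefficients
    that depend on the past only. *)
Lemma brownian_energy (U0 : Omega -> R) (U : 'I_m -> Omega -> R) :
  measurable_fun [set: g_sigma_algebraType (F s)] U0 ->
  (forall i, measurable_fun [set: g_sigma_algebraType (F s)] (U i)) ->
  (\int[P]_w (U0 w ^+ 2)%:E < +oo)%E ->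
  (forall i, \int[P]_w (U i w ^+ 2)%:E < +oo)%E ->
  (\int[P]_w ((U0 w + \sum_i U i w * dW w i 0) ^+ 2)%:E
   <= \int[P]_w (U0 w ^+ 2)%:E + (t - s)%:E * \sum_i \int[P]_w (U i w ^+ 2)%:E)%E.
Proof.
move=> mU0 mU sU0 sU.
pose Us (j : option 'I_m) := if j is Some i then U i else U0.
pose c (j : option 'I_m) := if j is Some i then t - s else 1.
have mUs j : measurable_fun [set: g_sigma_algebraType (F s)] (Us j).
  by case: j => [i|]; [exact: mU|exact: mU0].
have -> : (\int[P]_w ((U0 w + \sum_i U i w * dW w i 0) ^+ 2)%:E =
           \int[P]_w ((\sum_j Us j w * wt j w) ^+ 2)%:E)%E.
  apply: eq_integral => w _; rewrite big_option /= mulr1.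
  by [].
apply: (le_trans (square_integral_uncorrelated (c := c) _ _ _ _ _)).
- by move=> j; split; [exact: adapted_measurable (mUs j)|case: j => [i|]; [exact: sU|exact: sU0]].
- by case=> [i|]; [have [] := increment_moments i|exact: square_integrable_cst].
- move=> i j.
  pose h (k : option 'I_m) (v : 'cV[R]_m) := if k is Some l then v l 0 else 1.
  rewrite (_ : (fun x => wt i x * wt j x) = (fun x => (h i \* h j) (dW x))); last first.
    by apply/funext => w; case: i; case: j.
  apply: increment_independent; first exact: measurable_funM.
  have mh k : measurable_fun [set: g_sigma_algebraType [set V : set 'cV[R]_m | open V]] (h k).
    by case: k => [l|]; [exact: borel_measurable_coord|exact: measurable_cst].
  exact: measurable_funM.
- case=> [i|] [j|]//= ij.
  + have [_ wi0 _] := increment_moments i.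
    have iw k : P.-integrable setT (EFin \o (fun w => dW w k 0)).
      have [sw _ _] := increment_moments k.
      have := square_integrable_mul sw (square_integrable_cst P 1).
      by apply: eq_integrable => // w _; rewrite /= mulr1.
    rewrite (integral_independent_prod (iw i) (iw j)) ?wi0 ?mul0e//.
    exact: increment_coord_independent.
  + by under eq_integral do rewrite mulr1; have [] := increment_moments i.
  + by under eq_integral do rewrite mul1r; have [] := increment_moments j.
- case=> [i|] /=; first by have [] := increment_moments i.
  under eq_integral do rewrite expr1n.
  rewrite integral_cst// mul1e; exact: probability_le1.
rewrite big_option /= mule1 leeD// ge0_sume_distrr; last first.
  by move=> i _; apply: integral_ge0 => w _; rewrite lee_fin sqr_ge0.
by apply: lee_sum => i _; rewrite muleC.
Qed.

End brownian_increment.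

(** * Trace norm and random vectors *)

Section trace_norm_theory.
Context (R : realType).

Lemma trace_norm_sqr d m (A : 'M[R]_(d, m)) :
  trace_norm A ^+ 2 = \sum_i \sum_j A i j ^+ 2.
Proof.
have trE : \tr (A^T *m A) = \sum_i \sum_j A i j ^+ 2.
  rewrite exchange_big; apply: eq_bigr => j _; rewrite mxE.
  by apply: eq_bigr => i _; rewrite mxE expr2.
by rewrite sqr_sqrtr trE//; do 2 (apply: sumr_ge0 => ? _); exact: sqr_ge0.
Qed.

Lemma trace_norm_ge0 d m (A : 'M[R]_(d, m)) : 0 <= trace_norm A.
Proof. exact: sqrtr_ge0. Qed.

Lemma dotpp d (x : 'cV[R]_d) : dotp x x = trace_norm x ^+ 2.
Proof.
by rewrite trace_norm_sqr; apply: eq_bigr => i _; rewrite big_ord1 expr2.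
Qed.

Lemma dotpC d (x y : 'cV[R]_d) : dotp x y = dotp y x.
Proof. by apply: eq_bigr => i _; rewrite mulrC. Qed.

Lemma dotpBr d (x y z : 'cV[R]_d) : dotp x (y - z) = dotp x y - dotp x z.
Proof. by rewrite -sumrB; apply: eq_bigr => i _; rewrite !mxE mulrBr. Qed.

Lemma dotpZr d (a : R) (x y : 'cV[R]_d) : dotp x (a *: y) = a * dotp x y.
Proof. by rewrite mulr_sumr; apply: eq_bigr => i _; rewrite !mxE mulrCA. Qed.

Lemma trace_norm_sqrB d (x y : 'cV[R]_d) :
  trace_norm (x - y) ^+ 2 = trace_norm x ^+ 2 - 2 * dotp x y + trace_norm y ^+ 2.
Proof.
rewrite -!dotpp dotpBr !(dotpC (x - y)) !dotpBr (dotpC y x); ring.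
Qed.

Lemma coord_le_trace_norm d (x : 'cV[R]_d) (i : 'I_d) : `|x i 0| <= trace_norm x.
Proof.
rewrite -ler_sqr ?nnegrE ?trace_norm_ge0// real_normK ?num_real//.
rewrite trace_norm_sqr (bigD1 i)//= big_ord1 lerDl.
by do 2 (apply: sumr_ge0 => ? _); exact: sqr_ge0.
Qed.

Lemma trace_norm_sqr_le d (x : 'cV[R]_d) (e : R) :
  (forall i, `|x i 0| <= e) -> trace_norm x ^+ 2 <= d%:R * e ^+ 2.
Proof.
move=> xe; rewrite trace_norm_sqr.
have -> : d%:R * e ^+ 2 = \sum_(i < d) e ^+ 2.
  by rewrite sumr_const card_ord mulr_natl.
apply: ler_sum => i _; rewrite big_ord1 -(real_normK (num_real (x i 0))).
by rewrite lerXn2r ?nnegrE//; exact: le_trans (xe i).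
Qed.

End trace_norm_theory.

Section vector_measurability.
Context disp (T : measurableType disp) (R : realType).

Definition coord_measurable d m (A : T -> 'M[R]_(d, m)) : Prop :=
  forall i j, measurable_fun setT (fun w => A w i j).

(** Open subsets of the product have measurable preimages by the box argument,
    which replaces a countable base of the product topology. *)
Lemma borel_preimage_pair d e (X : T -> 'cV[R]_d) (Y : T -> 'cV[R]_e)
    (C : set ('cV[R]_d * 'cV[R]_e)) :
  coord_measurable X -> coord_measurable Y ->
  borel ('cV[R]_d * 'cV[R]_e)%type C -> measurable ((fun w => (X w, Y w)) @^-1` C).
Proof.
move=> mX mY.
suff : measurable_fun setT ((fun w => (X w, Y w)) : T ->
    g_sigma_algebraType [set U : set ('cV[R]_d * 'cV[R]_e) | open U]).
  by move=> mXY bC; rewrite -[_ @^-1` _]setTI; exact: mXY.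
apply: (@measurability _ _ T
  (g_sigma_algebraType [set U : set ('cV[R]_d * 'cV[R]_e) | open U]) setT _
  [set U : set ('cV[R]_d * 'cV[R]_e) | open U]) => //.
move=> _ [U oU <-]; rewrite setTI.
pose h (k : 'I_d + 'I_e) w : R := match k with inl i => X w i 0 | inr i => Y w i 0 end.
apply: (measurable_initially_open (h := h)); first by case=> i; [exact: mX|exact: mY].
move=> w Uw; have : nbhs (X w, Y w) U by exact: open_nbhs_nbhs.
rewrite -nbhs_ballE => -[e' /= e0 eU]; exists e' => // w' near_w.
apply: eU; split; (split => // i j); rewrite (ord1 j) /ball /= distrC.
- exact: (near_w (inl i)).
- exact: (near_w (inr i)).
Qed.

Lemma coord_measurable_borel d e n m (X : T -> 'cV[R]_d) (Y : T -> 'cV[R]_e)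
    (g : 'cV[R]_d -> 'cV[R]_e -> 'M[R]_(n, m)) :
  borel_measurable (fun z : 'cV[R]_d * 'cV[R]_e => g z.1 z.2) ->
  coord_measurable X -> coord_measurable Y ->
  coord_measurable (fun w => g (X w) (Y w)).
Proof.
move=> bg mX mY i j _ B mB; rewrite setTI.
pose C := (fun z : 'cV[R]_d * 'cV[R]_e => g z.1 z.2) @^-1`
  ((fun v : 'M[R]_(n, m) => v i j) @^-1` B).
apply: (borel_preimage_pair (C := C)) => //; apply: bg.
by rewrite -[_ @^-1` _]setTI; exact: borel_measurable_coord.
Qed.

Lemma measurable_trace_norm d m (A : T -> 'M[R]_(d, m)) : coord_measurable A ->
  measurable_fun setT (fun w => trace_norm (A w)).
Proof.
move=> mA.
rewrite (_ : (fun w => _) = (fun w => Num.sqrt (\sum_i \sum_j A w i j ^+ 2))); last first.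
  apply/funext => w; rewrite -trace_norm_sqr sqrtr_sqr ger0_norm//.
  exact: trace_norm_ge0.
apply: measurableT_comp.
  by apply: continuous_measurable_fun; exact: sqrt_continuous.
apply: measurable_sum => i; apply: measurable_sum => j.
exact: measurable_funX.
Qed.

(** [X] is a function of [(Y, Z)] which is Lipschitz on the range of this pair,
    hence preimages of open sets are open in the coordinates of [Y] and [Z]. *)
Lemma coord_measurable_stable d e n (X : T -> 'cV[R]_d) (Y : T -> 'cV[R]_e)
    (Z : T -> 'cV[R]_n) (c : R) :
  coord_measurable Y -> coord_measurable Z -> 0 <= c ->
  (forall w w', trace_norm (X w - X w') ^+ 2 <=
     c * (trace_norm (Y w - Y w') ^+ 2 + trace_norm (Z w - Z w') ^+ 2)) ->
  coord_measurable X.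
Proof.
move=> mY mZ c0 stable i j.
apply: (measurability _ (RGenOpens.measurableE R)) => _ [B [a [b ->]] <-].
rewrite setTI.
pose h (k : 'I_e + 'I_n) w : R := match k with inl i => Y w i 0 | inr i => Z w i 0 end.
apply: (measurable_initially_open (h := h)); first by case=> k; [exact: mY|exact: mZ].
move=> w /= Xab; rewrite (ord1 j) in Xab *.
have : nbhs (X w i 0) `]a, b[%classic by apply: open_nbhs_nbhs; split => //; exact: interval_open.
rewrite -nbhs_ballE => -[eps /= eps0 epsU].
(* The constant [1] is added to make [K] positive and the final bound strict. *)
pose K := c * (e%:R + n%:R) + 1.
have K0 : 0 < K by rewrite ltr_wpDl// mulr_ge0// addr_ge0.
exists (eps / K).
  by rewrite divr_gt0.
move=> w' near_w; apply: epsU; rewrite /ball /= distrC.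
have {}near_w k : `|h k w' - h k w| <= eps / K by exact/ltW/near_w.
have dY : trace_norm (Y w' - Y w) ^+ 2 <= e%:R * (eps / K) ^+ 2.
  by apply: trace_norm_sqr_le => k; rewrite !mxE; exact: (near_w (inl k)).
have dZ : trace_norm (Z w' - Z w) ^+ 2 <= n%:R * (eps / K) ^+ 2.
  by apply: trace_norm_sqr_le => k; rewrite !mxE; exact: (near_w (inr k)).
have dX : `|(X w' - X w) i 0| <= trace_norm (X w' - X w) by exact: coord_le_trace_norm.
rewrite !mxE in dX.
apply: (le_lt_trans dX).
rewrite -ltr_sqr ?nnegrE ?trace_norm_ge0 ?(ltW eps0)//.
apply: (le_lt_trans (stable _ _)).
apply: (@le_lt_trans _ _ ((K - 1) * (eps / K) ^+ 2)).
  rewrite /K addrK -mulrA ler_wpM2l// mulrDl; exact: lerD.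
rewrite expr_div_n mulrA ltr_pdivrMr ?exprn_gt0// mulrC ltr_pM2l ?exprn_gt0//.
have K1 : 1 <= K by rewrite lerDr mulr_ge0// addr_ge0.
by rewrite expr2; nra.
Qed.

End vector_measurability.

Section vector_brownian_energy.
Context (R : realType) (disp : measure_display) (Omega : measurableType disp)
  (P : probability Omega R) (F : R -> set (set Omega)) (m : nat)
  (W : R -> Omega -> 'cV[R]_m).
Hypotheses (F_usual : usual_filtration P F) (W_bm : brownian_motion P F W).
Variables (s t : R).
Hypotheses (s_ge0 : 0 <= s) (s_lt_t : s < t).

Lemma integral_trace_norm_sqr d n (A : Omega -> 'M[R]_(d, n)) : coord_measurable A ->
  (\int[P]_w (trace_norm (A w) ^+ 2)%:E
   = \sum_i \sum_j \int[P]_w (A w i j ^+ 2)%:E)%E.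
Proof.
move=> mA.
have mA2 i j : measurable_fun setT (fun w => (A w i j ^+ 2)%:E).
  by apply/measurable_EFinP; exact: measurable_funX.
under eq_integral => w _.
  rewrite trace_norm_sqr -sumEFin.
  under eq_bigr do rewrite -sumEFin.
  over.
rewrite ge0_integral_sum//.
- apply: eq_bigr => i _; rewrite ge0_integral_sum// => j w _.
  by rewrite lee_fin sqr_ge0.
- by move=> i; exact: emeasurable_sum.
- by move=> i w _; apply: sume_ge0 => j _; rewrite lee_fin sqr_ge0.
Qed.

Lemma vector_brownian_energy d (X : Omega -> 'cV[R]_d) (G : Omega -> 'M[R]_(d, m)) :
  coord_measurable (X : g_sigma_algebraType (F s) -> _) ->
  coord_measurable (G : g_sigma_algebraType (F s) -> _) ->
  (\int[P]_w (trace_norm (X w) ^+ 2)%:E < +oo)%E ->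
  (\int[P]_w (trace_norm (G w) ^+ 2)%:E < +oo)%E ->
  (\int[P]_w (trace_norm (X w + G w *m (W t w - W s w)) ^+ 2)%:E
   <= \int[P]_w (trace_norm (X w) ^+ 2)%:E
      + (t - s)%:E * \int[P]_w (trace_norm (G w) ^+ 2)%:E)%E.
Proof.
move=> mX mG.
have mX' : coord_measurable X by move=> i j; exact: (adapted_measurable F_usual s_ge0).
have mG' : coord_measurable G by move=> i j; exact: (adapted_measurable F_usual s_ge0).
have mS : coord_measurable (fun w => X w + G w *m (W t w - W s w)).
  move=> i j; rewrite (_ : (fun w => _) = (fun w => X w i j) \+
      (fun w => \sum_k G w i k * (W t w - W s w) k 0)); last first.
    by apply/funext => w; rewrite !mxE (ord1 j).
  apply: measurable_funD => //; apply: measurable_sum => k.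
  by apply: measurable_funM => //; exact: (measurable_increment F_usual W_bm).
have sq_ge0 (U : Omega -> R) : (0 <= \int[P]_w (U w ^+ 2)%:E)%E.
  by apply: integral_ge0 => w _; rewrite lee_fin sqr_ge0.
rewrite !integral_trace_norm_sqr// => fX fG.
have fXi i : (\int[P]_w (X w i 0 ^+ 2)%:E < +oo)%E.
  apply: le_lt_trans fX; rewrite (bigD1 i)//= big_ord1 leeDl//.
  by apply: sume_ge0 => k _; apply: sume_ge0 => l _.
have fGi i k : (\int[P]_w (G w i k ^+ 2)%:E < +oo)%E.
  apply: le_lt_trans fG; rewrite (bigD1 i)//= (bigD1 k)//= -addeA leeDl//.
  by apply: adde_ge0; apply: sume_ge0 => ? _ //; apply: sume_ge0 => ? _.
rewrite ge0_sume_distrr; last by move=> i _; apply: sume_ge0.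
rewrite -big_split; apply: lee_sum => i _ /=; rewrite !big_ord1.
apply: le_trans (brownian_energy F_usual W_bm s_ge0 s_lt_t (mX i 0) (mG i) (fXi i) (fGi i)).
rewrite le_eqVlt; apply/orP; left; apply/eqP.
by apply: eq_integral => w _; rewrite !mxE.
Qed.

End vector_brownian_energy.

(** * One implicit step *)

Section implicit_step.
Context (R : realType) (d m : nat) (q : R) (f : 'cV[R]_d -> 'cV[R]_d -> 'cV[R]_d).

(** Since [z - z' = (x - x') - D (f x y - f x' y')], expanding the square and
    using monotonicity bounds [|z - z'|^2] below by [|x - x'|^2] minus the
    contribution of the delay. *)
Lemma implicit_step_stable (b1 b2 b3 D : R) (x x' y y' z z' : 'cV[R]_d) :
  0 <= b1 -> 0 <= b3 -> 0 <= D ->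
  2 * dotp (x - x') (f x y - f x' y') <=
      - b1 * trace_norm (x - x') ^+ 2 + b2 * trace_norm (y - y') ^+ 2
      - b3 * V q x x' ->
  x = z + D *: f x y -> x' = z' + D *: f x' y' ->
  trace_norm (x - x') ^+ 2
    <= D * b2 * trace_norm (y - y') ^+ 2 + trace_norm (z - z') ^+ 2.
Proof.
move=> b1_ge0 b3_ge0 D_ge0 mono xE xE'.
have -> : z - z' = (x - x') - D *: (f x y - f x' y').
  rewrite {1}xE {1}xE' scalerBr; apply/matrixP => i j; rewrite !mxE; ring.
rewrite [X in _ <= _ + X]trace_norm_sqrB dotpZr.
have V0 : 0 <= V q x x' by rewrite mulr_ge0 ?sqr_ge0// addr_ge0 ?powR_ge0.
have := ler_wpM2l D_ge0 mono.
have := mulr_ge0 D_ge0 (mulr_ge0 b3_ge0 V0).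
have := mulr_ge0 D_ge0 (mulr_ge0 b1_ge0 (sqr_ge0 (trace_norm (x - x')))).
have := sqr_ge0 (trace_norm (D *: (f x y - f x' y'))).
lra.
Qed.

(** Expand the square of [z = x - D f x y] and drop [D^2 |f x y|^2]. *)
Lemma implicit_step_energy (l2 b9 b10 b11 b12 b13 D : R) (g : 'M[R]_(d, m))
    (x y z : 'cV[R]_d) : 0 <= D ->
  2 * dotp x (f x y) + l2 * trace_norm g ^+ 2 <=
      b9 - b10 * trace_norm x ^+ 2 + b11 * trace_norm y ^+ 2
      - b12 * trace_norm x `^ (q + 1) + b13 * trace_norm y `^ (q + 1) ->
  x = z + D *: f x y ->
  (1 + b10 * D) * trace_norm x ^+ 2 + l2 * D * trace_norm g ^+ 2
    + b12 * D * trace_norm x `^ (q + 1)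
  <= trace_norm z ^+ 2 + b9 * D + b11 * D * trace_norm y ^+ 2
    + b13 * D * trace_norm y `^ (q + 1).
Proof.
move=> D_ge0 coercive xE.
have -> : z = x - D *: f x y by rewrite {1}xE addrK.
rewrite trace_norm_sqrB dotpZr.
have := ler_wpM2l D_ge0 coercive.
have := sqr_ge0 (trace_norm (D *: f x y)).
lra.
Qed.

End implicit_step.

(** * The backward Euler-Maruyama scheme *)

Section bem.
Context (R : realType) (d m : nat)
  (disp : measure_display) (Omega : measurableType disp)
  (P : probability Omega R) (F : R -> set (set Omega))
  (W : R -> Omega -> 'cV[R]_m)
  (F_usual : usual_filtration P F) (W_bm : brownian_motion P F W)
  (f : 'cV[R]_d -> 'cV[R]_d -> 'cV[R]_d)
  (g : 'cV[R]_d -> 'cV[R]_d -> 'M[R]_(d, m))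
  (g_borel : borel_measurable (fun z : 'cV[R]_d * 'cV[R]_d => g z.1 z.2))
  (xi : R -> 'cV[R]_d) (M : nat) (D : R) (X : int -> Omega -> 'cV[R]_d).
Hypotheses (D_gt0 : 0 < D) (M_gt0 : (0 < M)%N) (X_bem : BEM f g W xi M D X).

Variables (q b1 b2 b3 b9 b10 b11 b12 b13 l2 : R).
Hypotheses (b1_ge0 : 0 <= b1) (b2_ge0 : 0 <= b2) (b3_ge0 : 0 <= b3).
Hypotheses (b10_ge0 : 0 <= b10) (b12_gt0 : 0 < b12) (l2_gt0 : 0 < l2).
Hypothesis mono : forall x x' y y',
    2 * dotp (x - x') (f x y - f x' y') <=
      - b1 * trace_norm (x - x') ^+ 2 + b2 * trace_norm (y - y') ^+ 2
      - b3 * V q x x'.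
Hypothesis coercive : forall x y,
    2 * dotp x (f x y) + l2 * trace_norm (g x y) ^+ 2 <=
      b9 - b10 * trace_norm x ^+ 2 + b11 * trace_norm y ^+ 2
      - b12 * trace_norm x `^ (q + 1) + b13 * trace_norm y `^ (q + 1).

Let t (n : nat) : R := n%:R * D.
Let t_ge0 n : 0 <= t n. Proof. by rewrite mulr_ge0 ?ler0n// ltW. Qed.
Let tS n : t n < t n.+1. Proof. by rewrite ltr_pM2r// ltr_nat. Qed.
Let tSB n : t n.+1 - t n = D. Proof. by rewrite /t -mulrBl -natrB// subSnn mul1r. Qed.

Let G (k : int) w := g (X k w) (X (k - M%:Z) w).
(** The explicit part of the step from [t n] to [t n.+1]. *)
Let Z (n : nat) w := X n%:Z w + G n%:Z w *m (W (t n.+1) w - W (t n) w).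

Let X_step n w : X n.+1%:Z w = Z n w + D *: f (X n.+1%:Z w) (X (n.+1%:Z - M%:Z) w).
Proof.
have k1 : 1 <= n.+1%:Z by [].
rewrite {1}(BEM_step X_bem w k1) /Z /G /t.
have -> : n.+1%:Z - 1 = n%:Z by clear; lia.
have -> : n.+1%:Z - M%:Z - 1 = n%:Z - M%:Z by clear; lia.
by rewrite addrAC.
Qed.

Let X_init k w : - M%:Z <= k -> k <= 0 -> X k w = xi (k%:~R * D).
Proof. exact: (BEM_init X_bem). Qed.

Let coord_wrt n e l (A : Omega -> 'M[R]_(e, l)) :=
  coord_measurable (A : g_sigma_algebraType (F (t n)) -> _).

Let coord_wrtW n e l (A : Omega -> 'M[R]_(e, l)) : coord_wrt n A -> coord_wrt n.+1 A.
Proof.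
by move=> mA i j; apply: (adapted_le F_usual (t_ge0 n) (ltW (tS n))); exact: mA.
Qed.

(** [X n.+1] depends in a Lipschitz way on the explicit part [Z n] and on the
    delayed value, both of which are known at time [t n.+1]. *)
Lemma bem_adapted (n : nat) (k : int) : - M%:Z <= k -> k <= n%:Z ->
  coord_measurable (X k : g_sigma_algebraType (F (t n)) -> _).
Proof.
elim: n k => [|n IH] k kM kn.
  rewrite (_ : X k = cst (xi (k%:~R * D))); first by move=> i j; exact: measurable_cst.
  by apply/funext => w; exact: X_init.
have [{}kn|kn'] := leP k n%:Z; first by apply: coord_wrtW; exact: IH.
have -> : k = n.+1%:Z by move: kn kn'; clear; lia.
have mX : coord_wrt n (X n%:Z) by apply: IH; clear; lia.
have mXM : coord_wrt n (X (n%:Z - M%:Z)) by apply: IH; clear; lia.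
have mG : coord_wrt n (G n%:Z) by exact: coord_measurable_borel.
have mZ : coord_wrt n.+1 (Z n).
  move=> i j; rewrite (_ : (fun w => _) = (fun w => X n%:Z w i j) \+
      (fun w => \sum_l G n%:Z w i l * (W (t n.+1) w l 0 - W (t n) w l 0))); last first.
    by apply/funext => w; rewrite !mxE (ord1 j); congr (_ + _); apply: eq_bigr => l _; rewrite !mxE.
  apply: measurable_funD; first exact: coord_wrtW.
  apply: measurable_sum => l; apply: measurable_funM; first exact: coord_wrtW.
  apply: measurable_funB; first exact: (brownian_adapted F_usual W_bm).
  apply: (adapted_le F_usual (t_ge0 n) (ltW (tS n))).
  exact: (brownian_adapted F_usual W_bm).
have mY : coord_wrt n.+1 (X (n.+1%:Z - M%:Z)).
  by apply: coord_wrtW; apply: IH; move: M_gt0; clear; lia.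
apply: (coord_measurable_stable (c := D * b2 + 1) mY mZ).
  by rewrite addr_ge0// mulr_ge0// ltW.
move=> w w'.
apply: (le_trans (implicit_step_stable b1_ge0 b3_ge0 (ltW D_gt0)
  (mono _ _ _ _) (X_step n w) (X_step n w'))).
have := sqr_ge0 (trace_norm (X (n.+1%:Z - M%:Z) w - X (n.+1%:Z - M%:Z) w')).
have := sqr_ge0 (trace_norm (Z n w - Z n w')).
have := mulr_ge0 (ltW D_gt0) b2_ge0.
set c := D * b2; nra.
Qed.

Let pw (k : int) w := trace_norm (X k w) `^ (q + 1).

Let finite_moments (k : int) :=
  [/\ finite_mean P (fun w => trace_norm (X k w) ^+ 2),
      finite_mean P (fun w => pw k w) &
      0 <= k -> finite_mean P (fun w => trace_norm (G k w) ^+ 2)].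

Let bem_measurable k : - M%:Z <= k -> coord_measurable (X k).
Proof.
move=> kM i j.
have kn : k <= `|k|%N%:Z by clear; lia.
exact: (adapted_measurable F_usual (t_ge0 _) (bem_adapted kM kn i j)).
Qed.

Let bem_G_measurable k : 0 <= k -> coord_measurable (G k).
Proof.
move=> k0; apply: coord_measurable_borel => //;
by apply: bem_measurable; move: k0; clear; lia.
Qed.

Let measurable_sq e l (A : Omega -> 'M[R]_(e, l)) : coord_measurable A ->
  measurable_fun setT (fun w => (trace_norm (A w) ^+ 2)%:E).
Proof.
by move=> mA; apply/measurable_EFinP/measurable_funX; exact: measurable_trace_norm.
Qed.

Let measurable_pw k : - M%:Z <= k -> measurable_fun setT (fun w => (pw k w)%:E).
Proof.
move=> kM; apply/measurable_EFinP.
apply: (@measurableT_comp _ _ _ _ _ _ (fun x : R => x `^ (q + 1))) => //.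
by apply: measurable_trace_norm; exact: bem_measurable.
Qed.

Let rhs n w := trace_norm (Z n w) ^+ 2 + b9 * D
  + b11 * D * trace_norm (X (n.+1%:Z - M%:Z) w) ^+ 2 + b13 * D * pw (n.+1%:Z - M%:Z) w.

Let lhs n w := (1 + b10 * D) * trace_norm (X n.+1%:Z w) ^+ 2
  + l2 * D * trace_norm (G n.+1%:Z w) ^+ 2 + b12 * D * pw n.+1%:Z w.

Let lhs_le_rhs n w : lhs n w <= rhs n w.
Proof. exact: (implicit_step_energy (ltW D_gt0) (coercive _ _) (X_step n w)). Qed.

Let Z_energy n : finite_moments n%:Z ->
  (\int[P]_w (trace_norm (Z n w) ^+ 2)%:E <=
    \int[P]_w (trace_norm (X n%:Z w) ^+ 2)%:E
    + D%:E * \int[P]_w (trace_norm (G n%:Z w) ^+ 2)%:E)%E.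
Proof.
move=> [iX _ /(_ isT) iG].
have mX k : - M%:Z <= k -> k <= n%:Z -> coord_wrt n (X k) by exact: bem_adapted.
have sq_lty e l (A : Omega -> 'M[R]_(e, l)) :
    finite_mean P (fun w => trace_norm (A w) ^+ 2) ->
    (\int[P]_w (trace_norm (A w) ^+ 2)%:E < +oo)%E.
  by move=> iA; exact: integrable_lty.
rewrite -(tSB n); apply: (vector_brownian_energy F_usual W_bm (t_ge0 n) (tS n)).
- by apply: mX; clear; lia.
- by apply: coord_measurable_borel => //; apply: mX; clear; lia.
- exact: sq_lty.
- exact: sq_lty.
Qed.

Let Z_measurable n : coord_measurable (Z n).
Proof.
move=> i j; rewrite (_ : (fun w => _) = (fun w => X n%:Z w i j) \+
    (fun w => \sum_l G n%:Z w i l * (W (t n.+1) w - W (t n) w) l 0)); last first.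
  by apply/funext => w; rewrite !mxE (ord1 j).
apply: measurable_funD; first by apply: bem_measurable; clear; lia.
apply: measurable_sum => l; apply: measurable_funM; first by apply: bem_G_measurable.
exact: (measurable_increment F_usual W_bm).
Qed.

Let Z_integrable n : finite_moments n%:Z ->
  finite_mean P (fun w => trace_norm (Z n w) ^+ 2).
Proof.
move=> fin; have [iX _ /(_ isT) iG] := fin.
apply/integrableP; split; first exact/measurable_sq/Z_measurable.
under eq_integral do rewrite gee0_abs ?lee_fin ?sqr_ge0//.
apply: (le_lt_trans (Z_energy fin)).
rewrite -(fineK (integrable_fin_num measurableT iX)).
by rewrite -(fineK (integrable_fin_num measurableT iG)) -EFinM -EFinD ltry.
Qed.

Let rhs_integrable n : finite_moments n%:Z -> finite_moments (n.+1%:Z - M%:Z) ->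
  finite_mean P (fun w => rhs n w).
Proof.
move=> fin [iY ipY _].
have := integrableD measurableT (integrableD measurableT (integrableD measurableT
  (Z_integrable fin) (finite_mean_cst P (b9 * D)))
  (integrableZl measurableT (b11 * D) iY)) (integrableZl measurableT (b13 * D) ipY).
exact.
Qed.

Let pw_ge0 k w : 0 <= pw k w. Proof. exact: powR_ge0. Qed.

Let D_ge0 : 0 <= D. Proof. exact: ltW. Qed.

(** Once the moments at earlier times are finite, the right side of the pathwise
    energy inequality is integrable, and it dominates each term of the left
    side; this is where [b12 > 0] and [l2 > 0] enter. *)
Lemma bem_finite_moments (n : nat) (k : int) : - M%:Z <= k -> k <= n%:Z ->
  finite_moments k.
Proof.
elim: n k => [|n IH] k kM kn.
  have Xk w : X k w = xi (k%:~R * D) by exact: X_init.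
  split; rewrite /pw /G.
  - by under eq_fun do rewrite Xk; exact: finite_mean_cst.
  - by under eq_fun do rewrite Xk; exact: finite_mean_cst.
  - move=> k0; have kME w : X (k - M%:Z) w = xi ((k - M%:Z)%:~R * D).
      by apply: X_init; move: kn k0; clear; lia.
    by under eq_fun do rewrite Xk kME; exact: finite_mean_cst.
have [{}kn|kn'] := leP k n%:Z; first exact: IH.
have -> : k = n.+1%:Z by move: kn kn'; clear; lia.
have irhs : finite_mean P (fun w => rhs n w).
  by apply: rhs_integrable; apply: IH; move: M_gt0; clear; lia.
have lhs_terms w : [/\ 0 <= b10 * D * trace_norm (X n.+1%:Z w) ^+ 2,
    0 <= trace_norm (X n.+1%:Z w) ^+ 2,
    0 <= l2 * D * trace_norm (G n.+1%:Z w) ^+ 2 & 0 <= b12 * D * pw n.+1%:Z w].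
  split; rewrite ?sqr_ge0//; apply: mulr_ge0 => //; rewrite ?sqr_ge0//;
    by apply: mulr_ge0 => //; exact: ltW.
have dominated (h : Omega -> R) (c : R) : 0 < c ->
    measurable_fun setT (fun w => (h w)%:E) -> (forall w, 0 <= h w) ->
    (forall w, c * h w <= rhs n w) -> finite_mean P (fun w => h w).
  move=> c0 mh h0 hrhs.
  apply: (le_integrable measurableT mh _ (integrableZl measurableT c^-1 irhs)).
  move=> w _; rewrite /= lee_fin ger0_norm//.
  apply: le_trans (ler_norm _).
  by rewrite -(ler_pM2l c0) mulrA divff ?mul1r// gt_eqF.
split.
- apply: (dominated _ 1) => //.
  + by apply: measurable_sq; apply: bem_measurable; clear; lia.
  + by move=> w; exact: sqr_ge0.
  + move=> w; apply: le_trans (lhs_le_rhs n w); rewrite /lhs.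
    by have [] := lhs_terms w; lra.
- apply: (dominated _ (b12 * D)) => //; first exact: mulr_gt0.
  + by apply: measurable_pw; clear; lia.
  + move=> w; apply: le_trans (lhs_le_rhs n w); rewrite /lhs.
    by have [] := lhs_terms w; lra.
- move=> _; apply: (dominated _ (l2 * D)) => //; first exact: mulr_gt0.
  + by apply: measurable_sq; exact: bem_G_measurable.
  + by move=> w; exact: sqr_ge0.
  + move=> w; apply: le_trans (lhs_le_rhs n w); rewrite /lhs.
    by have [] := lhs_terms w; lra.
Qed.

Let A k := (\int[P]_w (trace_norm (X k w) ^+ 2))%R.
Let Q k := (\int[P]_w (pw k w))%R.
Let B k := (\int[P]_w (trace_norm (G k w) ^+ 2))%R.

Let integral_const (h : Omega -> R) (c : R) : (forall w, h w = c) ->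
  (\int[P]_w h w)%R = c.
Proof. by move=> hc; under eq_Rintegral do rewrite hc; exact: mean_cst. Qed.

Lemma bem_mean_energy (n : nat) :
  (1 + b10 * D) * A n.+1%:Z + l2 * D * B n.+1%:Z + b12 * D * Q n.+1%:Z
  <= A n%:Z + D * B n%:Z + b9 * D + b11 * D * A (n.+1%:Z - M%:Z)
     + b13 * D * Q (n.+1%:Z - M%:Z).
Proof.
have fin (k : int) : - M%:Z <= k -> finite_moments k.
  by move=> kM; apply: (@bem_finite_moments `|k|%N) => //; clear; lia.
have finn : finite_moments n%:Z by apply: fin; clear; lia.
have [iX ipX /(_ isT) iG] : finite_moments n.+1%:Z by apply: fin; clear; lia.
have [iX0 _ /(_ isT) iG0] := finn.
have finY : finite_moments (n.+1%:Z - M%:Z) by apply: fin; clear; lia.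
have [iY ipY _] := finY.
have iZ : finite_mean P (fun w => trace_norm (Z n w) ^+ 2) := Z_integrable finn.
have ZE : (\int[P]_w (trace_norm (Z n w) ^+ 2))%R <= A n%:Z + D * B n%:Z.
  have := Z_energy finn.
  rewrite -(fineK (integrable_fin_num measurableT iX0)).
  rewrite -(fineK (integrable_fin_num measurableT iG0)).
  by rewrite -(fineK (integrable_fin_num measurableT iZ)) -EFinM -EFinD lee_fin.
have [ilhs Elhs] := mean_comb3 (1 + b10 * D) (l2 * D) (b12 * D) iX iG ipX.
have [irhs Erhs] := mean_comb3 (b11 * D) (b13 * D) 1 iY ipY
  (finite_meanD iZ (finite_mean_cst P (b9 * D))).
have pointwise w : setT w -> (1 + b10 * D) * trace_norm (X n.+1%:Z w) ^+ 2
    + l2 * D * trace_norm (G n.+1%:Z w) ^+ 2 + b12 * D * pw n.+1%:Z w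
  <= b11 * D * trace_norm (X (n.+1%:Z - M%:Z) w) ^+ 2
     + b13 * D * pw (n.+1%:Z - M%:Z) w + 1 * (trace_norm (Z n w) ^+ 2 + b9 * D).
  by move=> _; rewrite mul1r [leRHS]addrC [leRHS]addrA; exact: lhs_le_rhs.
have := le_Rintegral measurableT ilhs irhs pointwise.
rewrite Elhs Erhs (RintegralD measurableT iZ (finite_mean_cst P (b9 * D))) mean_cst mul1r.
move=> mean_le; apply: (le_trans mean_le).
by rewrite [leLHS]addrC [leLHS]addrA /A /Q !lerD2r; exact: ZE.
Qed.

Lemma bem_mean_init (k : int) : - M%:Z <= k -> k <= 0 ->
  A k = trace_norm (xi (k%:~R * D)) ^+ 2 /\ Q k = trace_norm (xi (k%:~R * D)) `^ (q + 1).
Proof.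
by move=> kM k0; split; apply: integral_const => w; rewrite /pw X_init.
Qed.

Lemma bem_mean_init_diffusion :
  B 0 = trace_norm (g (xi 0) (xi (- (M%:R * D)))) ^+ 2.
Proof.
have X0 w : X 0 w = xi 0 by rewrite X_init ?mul0r//; clear; lia.
have XM w : X (0 - M%:Z) w = xi (- (M%:R * D)).
  by rewrite X_init ?sub0r ?intrN ?mulNr//; clear; lia.
by apply: integral_const => w; rewrite /G X0 XM.
Qed.

End bem.

(** * Delayed recursive inequalities *)

(** Sequences are indexed from the start of the delay, so [a (n + M)] is the value
    at time [n] and [a n] is the value delayed by [M] steps. *)
Section delayed_gronwall.
Context (R : realType).
Variables (M : nat) (D lam E p b9 b11 b12 b13 alpha beta : R).
Variables (H a u : nat -> R).
Let S := 1 + lam * D.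
Hypotheses (D_gt0 : 0 < D) (lam_gt0 : 0 < lam) (S_le_E : S ^+ M <= E).
Hypotheses (b9_ge0 : 0 <= b9) (b11_ge0 : 0 <= b11) (b13_ge0 : 0 <= b13).
Hypotheses (p_dom : b11 * E <= p) (b12_dom : b13 * E < b12).
Hypotheses (H_ge0 : forall n, 0 <= H n) (a_ge0 : forall n, 0 <= a n) (u_ge0 : forall n, 0 <= u n).
Hypotheses (a_init : forall n, (n <= M)%N -> a n <= alpha)
  (u_init : forall n, (n <= M)%N -> u n <= beta).
Hypothesis step : forall n,
  S * H n.+1 + p * D * a (n.+1 + M)%N + b12 * D * u (n.+1 + M)%N
    <= H n + b9 * D + b11 * D * a n.+1 + b13 * D * u n.+1.

Let lamD : 0 < lam * D. Proof. exact: mulr_gt0. Qed.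
Let S_ge1 : 1 <= S. Proof. by rewrite lerDl ltW. Qed.
Let S_gt0 : 0 < S. Proof. exact: lt_le_trans S_ge1. Qed.
Let SX_ge0 n : 0 <= S ^+ n. Proof. by rewrite exprn_ge0// ltW. Qed.
Let SX_ge1 n : 1 <= S ^+ n. Proof. exact: exprn_ege1. Qed.
Let E_gt0 : 0 < E. Proof. exact: lt_le_trans (exprn_gt0 M S_gt0) S_le_E. Qed.

(** The one-step inequalities weighted by [S ^+ n], telescoped. *)
Let summed n :
  S ^+ n * H n + D * (p * (\sum_(j < n) S ^+ j * a (j.+1 + M)%N)
                      + b12 * (\sum_(j < n) S ^+ j * u (j.+1 + M)%N))
  <= H 0 + D * (b9 * (\sum_(j < n) S ^+ j) + b11 * (\sum_(j < n) S ^+ j * a j.+1)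
                 + b13 * (\sum_(j < n) S ^+ j * u j.+1)).
Proof.
elim: n => [|n IH]; first by rewrite !big_ord0 !mulr0 !addr0 mulr0 expr0 mul1r.
rewrite !big_ord_recr /=.
have := ler_wpM2l (SX_ge0 n) (step n).
rewrite exprS; move: IH.
set s1 := \sum_(j < n) _; set s2 := \sum_(j < n) _; set s3 := \sum_(j < n) _.
set s4 := \sum_(j < n) _; set s5 := \sum_(j < n) _; set s := S ^+ n.
move=> IH st; rewrite -subr_ge0 in IH; rewrite -subr_ge0 in st; rewrite -subr_ge0.
apply: le_trans (addr_ge0 IH st) _; rewrite le_eqVlt; apply/orP; left; apply/eqP; ring.
Qed.

Let geometric n : D * (lam * \sum_(j < n) S ^+ j) = S ^+ n - 1.
Proof.
elim: n => [|n IH]; first by rewrite big_ord0 expr0 !mulr0 subrr.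
by rewrite big_ord_recr /= !mulrDr IH exprS /S; ring.
Qed.

(** The first [M] delayed terms belong to the initial segment; the others are
    present terms, at the cost of [M] powers of [S]. *)
Let shift (y : nat -> R) (c : R) n : (forall n, 0 <= y n) ->
  (forall n, (n <= M)%N -> y n <= c) ->
  \sum_(j < n) S ^+ j * y j.+1
    <= E * (\sum_(j < n) S ^+ j * y (j.+1 + M)%N) + M%:R * E * c.
Proof.
move=> y0 yc.
have c0 : 0 <= c by exact: le_trans (yc 0 isT).
apply: (@le_trans _ _ (\sum_(j < n + M) S ^+ j * y j.+1)).
  rewrite big_split_ord /= lerDl; apply: sumr_ge0 => j _; exact: mulr_ge0.
rewrite addnC big_split_ord /= addrC lerD//.
  rewrite mulr_sumr; apply: ler_sum => j _.
  rewrite exprD mulrA -addnS addnC ler_wpM2r// ler_wpM2r//.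
have -> : M%:R * E * c = \sum_(j < M) E * c by rewrite sumr_const card_ord -mulrA mulr_natl.
apply: ler_sum => j _; apply: ler_pM => //; last exact: yc.
by apply: le_trans S_le_E; apply: ler_weXn2l => //; exact: ltnW.
Qed.

Let K := H 0 + b9 / lam + E * (M%:R * D) * (b11 * alpha + b13 * beta).

Let alpha_ge0 : 0 <= alpha. Proof. exact: le_trans (a_init (leq0n _)). Qed.
Let beta_ge0 : 0 <= beta. Proof. exact: le_trans (u_init (leq0n _)). Qed.

(** The delayed sum of [a] is absorbed since [b11 * E <= p]; that of [u] leaves the
    positive coefficient [b12 - b13 * E]. *)
Let weighted n : S ^+ n * H n
  + (b12 - b13 * E) * D * (\sum_(j < n) S ^+ j * u (j.+1 + M)%N) <= S ^+ n * K.
Proof.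
have := summed n.
have := shift n a_ge0 a_init; have := shift n u_ge0 u_init.
have := geometric n.
set sa := \sum_(j < n) S ^+ j * a (_ + _)%N; set su := \sum_(j < n) S ^+ j * u (_ + _)%N.
set sa' := \sum_(j < n) S ^+ j * a _; set su' := \sum_(j < n) S ^+ j * u _.
set g := \sum_(j < n) _ => gE hu ha hs.
have sa0 : 0 <= sa by apply: sumr_ge0 => j _; exact: mulr_ge0.
have K1 : H 0 + E * (M%:R * D) * (b11 * alpha + b13 * beta)
    <= S ^+ n * (H 0 + E * (M%:R * D) * (b11 * alpha + b13 * beta)).
  rewrite ler_peMl// addr_ge0//; apply: mulr_ge0.
    by apply: mulr_ge0; [exact: ltW|apply: mulr_ge0 => //; exact: ltW].
  by apply: addr_ge0; exact: mulr_ge0.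
have gD : D * (b9 * g) = b9 / lam * (S ^+ n - 1).
  by rewrite -gE; field; exact: lt0r_neq0.
have K2 : D * (b9 * g) <= S ^+ n * (b9 / lam).
  have := divr_ge0 b9_ge0 (ltW lam_gt0); rewrite gD; lra.
have k3 : D * (b11 * sa') <= D * (b11 * (E * sa + M%:R * E * alpha)).
  by rewrite ler_pM2l// ler_wpM2l.
have k4 : D * (b13 * su') <= D * (b13 * (E * su + M%:R * E * beta)).
  by rewrite ler_pM2l// ler_wpM2l.
have k5 : D * (b11 * E * sa) <= D * (p * sa).
  by rewrite ler_pM2l// ler_wpM2r.
rewrite /K; lra.
Qed.

Lemma delayed_gronwall_pointwise n : H n <= K.
Proof.
have := weighted n.
have : 0 <= (b12 - b13 * E) * D * (\sum_(j < n) S ^+ j * u (j.+1 + M)%N).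
  apply: mulr_ge0; first by apply: mulr_ge0; rewrite ?subr_ge0; exact: ltW.
  by apply: sumr_ge0 => j _; exact: mulr_ge0.
move=> h1 h2; rewrite -(ler_pM2l (exprn_gt0 n S_gt0)); lra.
Qed.

(** The window splits into initial terms, each at most [beta], and at most [M]
    consecutive terms of the weighted sum, whose weights are at least
    [S ^+ n / E]. *)
Lemma delayed_gronwall_window n :
  D * (\sum_(j < M) u (n.+1 + j)%N) <= M%:R * D * beta + E * K / (b12 - b13 * E).
Proof.
have c0 : 0 < b12 - b13 * E by rewrite subr_gt0.
(* The weighted terms re-indexed by [i = l + M], and 0 on the initial segment. *)
pose v i := if (M <= i)%N then S ^+ (i - M) * u i.+1 else 0.
have v0 i : 0 <= v i by rewrite /v; case: ifP => // _; exact: mulr_ge0.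
have vsum : \sum_(j < M) v (n + j)%N <= \sum_(l < n) S ^+ l * u (l.+1 + M)%N.
  apply: (@le_trans _ _ (\sum_(i < n + M) v i)).
    by rewrite big_split_ord /= lerDr; exact: sumr_ge0.
  rewrite addnC big_split_ord /= big1 ?add0r; last first.
    by move=> i _; rewrite /v leqNgt ltn_ord.
  by apply: ler_sum => l _; rewrite /v leq_addr addnC addnK addSn.
have term (j : 'I_M) : S ^+ n * u (n.+1 + j)%N <= S ^+ n * beta + E * v (n + j)%N.
  rewrite /v addSn; case: ifPn => [Mnj|].
    rewrite -[leLHS]add0r lerD ?mulr_ge0// mulrA ler_wpM2r//.
    apply: (@le_trans _ _ (S ^+ M * S ^+ (n + j - M))); last exact: ler_wpM2r.
    by rewrite -exprD (subnKC Mnj); apply: ler_weXn2l => //; exact: leq_addr.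
  by rewrite -ltnNge mulr0 addr0 => lt; rewrite ler_wpM2l// u_init.
have := weighted n; set G := \sum_(l < n) _ in vsum * => wn.
have G0 : 0 <= G by apply: le_trans vsum; exact: sumr_ge0.
have Hn0 : 0 <= S ^+ n * H n by exact: mulr_ge0.
have DG : D * G <= S ^+ n * K / (b12 - b13 * E).
  by rewrite ler_pdivlMr// -mulrA mulrC; lra.
rewrite -(ler_pM2l (exprn_gt0 n S_gt0)).
apply: (@le_trans _ _ (D * (\sum_(j < M) (S ^+ n * beta + E * v (n + j)%N)))).
  by rewrite mulrCA ler_pM2l// mulr_sumr; apply: ler_sum => j _; exact: term.
rewrite big_split /= sumr_const card_ord -mulr_sumr.
have : E * (D * (\sum_(j < M) v (n + j)%N)) <= E * (S ^+ n * K / (b12 - b13 * E)).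
  by rewrite ler_pM2l//; apply: le_trans DG; rewrite ler_pM2l.
rewrite -mulr_natl; move=> h.
rewrite mulrDr mulrDr lerD//; first by rewrite le_eqVlt; apply/orP; left; apply/eqP; ring.
rewrite mulrCA; apply: (le_trans h).
by rewrite le_eqVlt; apply/orP; left; apply/eqP; ring.
Qed.

End delayed_gronwall.

Section delayed_energy.
Context (R : realType).
Variables (M : nat) (D lam E b9 b10 b11 b12 b13 l2 alpha beta K : R).
Variables (A B Q : int -> R).
Hypotheses (D_gt0 : 0 < D) (lam_gt0 : 0 < lam) (lamD : 1 + lam * D <= l2)
  (growth : (1 + lam * D) ^+ M <= E).
Hypotheses (b9_ge0 : 0 <= b9) (b11_ge0 : 0 <= b11) (b13_ge0 : 0 <= b13).
Hypotheses (b10_dom : b11 * E <= b10 - lam) (b12_dom : b13 * E < b12).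
Hypotheses (A_ge0 : forall k, 0 <= A k) (B_ge0 : forall k, 0 <= B k)
  (Q_ge0 : forall k, 0 <= Q k).
Hypotheses (A_init : forall k, - M%:Z <= k -> k <= 0 -> A k <= alpha)
  (Q_init : forall k, - M%:Z <= k -> k <= 0 -> Q k <= beta).
Hypothesis energy : forall n : nat,
  (1 + b10 * D) * A n.+1%:Z + l2 * D * B n.+1%:Z + b12 * D * Q n.+1%:Z
  <= A n%:Z + D * B n%:Z + b9 * D + b11 * D * A (n.+1%:Z - M%:Z)
     + b13 * D * Q (n.+1%:Z - M%:Z).

(** The weight of [B] is such that [(1 + lam * D) * H n.+1] contains exactly
    [l2 * D * B n.+1], while [1 + lam * D <= l2] makes [H n] dominate
    [A n + D * B n]. *)
Let H (n : nat) := A n%:Z + l2 * D / (1 + lam * D) * B n%:Z.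

Hypothesis K_ge :
  H 0 + b9 / lam + E * (M%:R * D) * (b11 * alpha + b13 * beta) <= K.

Let S_gt0 : 0 < 1 + lam * D. Proof. by rewrite addr_gt0// mulr_gt0. Qed.

Let H_ge0 n : 0 <= H n.
Proof.
apply: addr_ge0 => //; apply: mulr_ge0 => //; apply: divr_ge0; last exact: ltW.
by apply: mulr_ge0; [exact: ltW (lt_le_trans S_gt0 lamD)|exact: ltW].
Qed.

Let a n := A (n%:Z - M%:Z).
Let u n := Q (n%:Z - M%:Z).

Let a_init n : (n <= M)%N -> a n <= alpha.
Proof. by move=> nM; apply: A_init; move: nM; clear; lia. Qed.

Let u_init n : (n <= M)%N -> u n <= beta.
Proof. by move=> nM; apply: Q_init; move: nM; clear; lia. Qed.

Let step n :
  (1 + lam * D) * H n.+1 + (b10 - lam) * D * a (n.+1 + M)%N + b12 * D * u (n.+1 + M)%N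
  <= H n + b9 * D + b11 * D * a n.+1 + b13 * D * u n.+1.
Proof.
rewrite /a /u; have -> : (n.+1 + M)%N%:Z - M%:Z = n.+1%:Z by clear; lia.
have SH : (1 + lam * D) * H n.+1 = (1 + lam * D) * A n.+1%:Z + l2 * D * B n.+1%:Z.
  by rewrite /H; field; exact: lt0r_neq0.
have DH : D * B n%:Z <= l2 * D / (1 + lam * D) * B n%:Z.
  by apply: ler_wpM2r => //; rewrite ler_pdivlMr// mulrC ler_pM2r.
have := energy n; rewrite SH /H; lra.
Qed.

Lemma delayed_energy_pointwise n : H n <= K.
Proof.
exact: le_trans (delayed_gronwall_pointwise D_gt0 lam_gt0 growth b9_ge0 b11_ge0
  b13_ge0 b10_dom b12_dom H_ge0 (fun=> A_ge0 _) (fun=> Q_ge0 _) a_init u_init step n) K_ge.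
Qed.

Lemma delayed_energy_window (n : nat) :
  D * (\sum_(j < M) Q (n%:Z - M%:Z + 1 + (j : nat)%:Z))
  <= M%:R * D * beta + E * K / (b12 - b13 * E).
Proof.
have := delayed_gronwall_window D_gt0 lam_gt0 growth b9_ge0 b11_ge0
  b13_ge0 b10_dom b12_dom H_ge0 (fun=> A_ge0 _) (fun=> Q_ge0 _) a_init u_init step n.
rewrite (eq_bigr (fun j : 'I_M => Q (n%:Z - M%:Z + 1 + (j : nat)%:Z))); last first.
  by move=> j _; congr Q; clear; lia.
move=> /le_trans; apply.
rewrite lerD2l ler_pM2r ?invr_gt0 ?subr_gt0// ler_wpM2l//.
by apply: le_trans growth; rewrite exprn_ge0// ltW.
Qed.

End delayed_energy.

(** * Bounds uniform in time and in the step size *)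

(** The supremum bounds the values only once the range is known to be bounded;
    coordinate by coordinate, this is the extreme value theorem. *)
Lemma C_ball_le (R : realType) d (tau r : R) (xi : R -> 'cV[R]_d) (th : R) :
  0 <= tau -> C_ball d tau r xi -> - tau <= th -> th <= 0 -> trace_norm (xi th) <= r.
Proof.
move=> tau0 [cxi xir] lo hi; apply: le_trans xir.
have coord_bound (i : 'I_d) : exists c, forall s, - tau <= s <= 0 -> `|xi s i 0| <= c.
  have Ntau : - tau <= 0 by rewrite oppr_le0.
  have ci : {within `[- tau, 0], continuous (fun s => `|xi s i 0|)}.
    move=> s; apply: (@continuous_comp _ _ _ (xi : subspace `[- tau, 0] -> _)
      (fun v : 'cV[R]_d => `|v i 0|)); first exact: cxi.
    apply: continuous_comp; first exact: coord_continuous.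
    exact: norm_continuous.
  have [c _ cmax] := EVT_max Ntau ci.
  by exists `|xi c i 0| => s sI; apply: cmax; rewrite in_itv.
have [c cP] := fin_all_exists coord_bound.
apply: ub_le_sup; last by exists th => //=; rewrite in_itv /= lo.
exists (Num.sqrt (\sum_i c i ^+ 2)) => _ [s /= sI <-].
rewrite in_itv /= in sI.
rewrite -[leLHS]ger0_norm ?trace_norm_ge0// -sqrtr_sqr trace_norm_sqr ler_wsqrtr//.
apply: ler_sum => i _; rewrite big_ord1 -(real_normK (num_real (xi s i 0))).
by rewrite lerXn2r ?nnegrE ?cP// (le_trans (normr_ge0 (xi s i 0)) (cP i s sI)).
Qed.

Theorem lemma4p1 (R : realType) (d m : nat) (tau : R) (tau_gt0 : 0 < tau)
  (disp : measure_display) (Omega : measurableType disp)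
  (P : probability Omega R) (F : R -> set (set Omega))
  (W : R -> Omega -> 'cV[R]_m)
  (F_usual : usual_filtration P F) (W_bm : brownian_motion P F W)
  (f : 'cV[R]_d -> 'cV[R]_d -> 'cV[R]_d)
  (g : 'cV[R]_d -> 'cV[R]_d -> 'M[R]_(d, m))
  (f_borel : borel_measurable (fun z : 'cV[R]_d * 'cV[R]_d => f z.1 z.2))
  (g_borel : borel_measurable (fun z : 'cV[R]_d * 'cV[R]_d => g z.1 z.2))
  (q a1 a2 a3 a4 a5 a6 a7 a8 a9 eps1 eps2 : R)
  (g1 g2 : 'cV[R]_d -> 'M[R]_(d, m))
  (fg_reg : regularity_condition f g
     q a1 a2 a3 a4 a5 a6 a7 a8 a9 eps1 eps2 g1 g2)
  (b1 b2 b3 b4 b5 b6 b7 b8 b9 b10 b11 b12 b13 l1 l2 : R)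
  (fg_dis : dissipativity_condition f g
     q a2 a3 a4 a5 b1 b2 b3 b4 b5 b6 b7 b8 b9 b10 b11 b12 b13 l1 l2)
  (r : R) (r_gt0 : 0 < r)
  (xi : R -> 'cV[R]_d) (xi_ball : C_ball d tau r xi)
  (lambda1 : R) (lambda1_gt0 : 0 < lambda1)
  (lambda1_b10 : 0 < b10 - lambda1 - b11 * expR (lambda1 * tau))
  (lambda1_b12 : 0 < b12 - b13 * expR (lambda1 * tau)) :
  exists Delta1 C : R, [/\ 0 < Delta1, 0 < C &
    forall M : nat, (0 < M)%N -> let Delta := tau / M%:R in
    Delta <= Delta1 ->
    forall X : int -> Omega -> 'cV[R]_d, BEM f g W xi M Delta X ->
    (ereal_sup
       [set 'E_P[fun w =>
               (trace_norm (X i w) ^+ 2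
                + (if 0 <= i then
                     l2 * Delta / (1 + lambda1 * Delta)
                       * trace_norm (g (X i w) (X (i - M%:Z) w)) ^+ 2
                   else 0))%R]
       | i in [set i : int | (- M%:Z <= i)%R]]
     + ereal_sup
       [set Delta%:E *
          \sum_(j < M)
             'E_P[fun w =>
                (trace_norm (X (k - M%:Z + 1 + (j : nat)%:Z) w)
                   `^ (q + 1))%R]
       | k in [set k : int | (0 <= k)%R]]
     <= C%:E)%E].
Proof.
have [q_ge2 _ _ _ _ _ _ _ _] := fg_reg.
have [[[b1_ge0 b2_ge0 b3_ge0 _ _] [[_ _ _ b9_ge0] [b10_ge0 b11_ge0 b12_ge0 b13_ge0]]]
  _ _ _ _ _ _ _ _ l2_gt1 mono _ coercive] := fg_dis.
pose E := expR (lambda1 * tau).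
pose beta := r `^ (q + 1).
pose c0 := trace_norm (g (xi 0) (xi (- tau))) ^+ 2.
(* [l2 * tau * c0] bounds the diffusion term at time 0 for every step size, as
   [D <= tau]. *)
pose K := r ^+ 2 + l2 * tau * c0 + b9 / lambda1 + E * tau * (b11 * r ^+ 2 + b13 * beta).
pose C2 := tau * beta + E * K / (b12 - b13 * E).
have E_gt0 : 0 < E by exact: expR_gt0.
have l2_gt0 : 0 < l2 by exact: lt_trans l2_gt1.
have beta_ge0 : 0 <= beta by exact: powR_ge0.
have q1_ge0 : 0 <= q + 1 by move: q_ge2; clear; lra.
have K_ge0 : 0 <= K.
  apply: addr_ge0; first (apply: addr_ge0; first (apply: addr_ge0; first exact: sqr_ge0)).
  - by apply: mulr_ge0; [apply: mulr_ge0; exact: ltW|exact: sqr_ge0].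
  - by apply: divr_ge0 => //; exact: ltW.
  - apply: mulr_ge0; first by apply: mulr_ge0; exact: ltW.
    by apply: addr_ge0; apply: mulr_ge0 => //; exact: sqr_ge0.
have C2_ge0 : 0 <= C2.
  apply: addr_ge0; first by apply: mulr_ge0 => //; exact: ltW.
  by apply: divr_ge0; [apply: mulr_ge0 => //; exact: ltW|exact: ltW].
(* This step bound is [1 + lambda1 * D <= l2]. *)
exists ((l2 - 1) / lambda1), (K + r ^+ 2 + C2 + 1); split.
- by rewrite divr_gt0// subr_gt0.
- by apply: ltr_wpDl => //; do 2 (apply: addr_ge0 => //); exact: sqr_ge0.
move=> M M_gt0 /=; set D := tau / M%:R => D_le X X_bem.
have M_gt0' : 0 < M%:R :> R by rewrite ltr0n.
have D_gt0 : 0 < D by exact: divr_gt0.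
have MD : M%:R * D = tau by rewrite /D mulrC divfK// gt_eqF.
have lamD : 1 + lambda1 * D <= l2.
  by move: D_le; rewrite ler_pdivlMr// mulrC -lerBrDl.
have growth : (1 + lambda1 * D) ^+ M <= E.
  have -> : E = expR (lambda1 * D) ^+ M.
    by rewrite /E -MD mulrCA expRM_natl.
  rewrite lerXn2r ?nnegrE ?expR_ge0 ?expR_ge1Dx//.
  by rewrite addr_ge0// mulr_ge0// ltW.
have b12_gt0 : 0 < b12.
  have : 0 <= b13 * E by apply: mulr_ge0 => //; exact: ltW.
  by move: lambda1_b12; rewrite -/E; clear; lra.
have init_le (k : int) : - M%:Z <= k -> k <= 0 -> trace_norm (xi (k%:~R * D)) <= r.
  move=> kM k0; apply: (C_ball_le (ltW tau_gt0) xi_ball).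
    rewrite -MD -mulNr ler_pM2r//.
    by rewrite -[X in - X]/(M%:Z%:~R) -intrN ler_int.
  by rewrite pmulr_lle0// lerz0.
pose A k := (\int[P]_w (trace_norm (X k w) ^+ 2))%R.
pose B k := (\int[P]_w (trace_norm (g (X k w) (X (k - M%:Z) w)) ^+ 2))%R.
pose Q k := (\int[P]_w (trace_norm (X k w) `^ (q + 1)))%R.
have fin := bem_finite_moments F_usual W_bm g_borel D_gt0 M_gt0 X_bem b1_ge0 b2_ge0
  b3_ge0 b10_ge0 b12_gt0 l2_gt0 mono coercive.
have energy := bem_mean_energy F_usual W_bm g_borel D_gt0 M_gt0 X_bem b1_ge0 b2_ge0
  b3_ge0 b10_ge0 b12_gt0 l2_gt0 mono coercive.
have A_ge0 k : 0 <= A k by apply: Rintegral_ge0 => w _; exact: sqr_ge0.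
have B_ge0 k : 0 <= B k by apply: Rintegral_ge0 => w _; exact: sqr_ge0.
have Q_ge0 k : 0 <= Q k by apply: Rintegral_ge0 => w _; exact: powR_ge0.
have A_init (k : int) : - M%:Z <= k -> k <= 0 -> A k <= r ^+ 2.
  move=> kM k0.
  have -> : A k = trace_norm (xi (k%:~R * D)) ^+ 2.
    by have [] := bem_mean_init P X_bem q kM k0.
  have xi_le := init_le k kM k0.
  by rewrite lerXn2r ?nnegrE ?trace_norm_ge0// (le_trans (trace_norm_ge0 _) xi_le).
have Q_init (k : int) : - M%:Z <= k -> k <= 0 -> Q k <= beta.
  move=> kM k0.
  have -> : Q k = trace_norm (xi (k%:~R * D)) `^ (q + 1).
    by have [] := bem_mean_init P X_bem q kM k0.
  have xi_le := init_le k kM k0.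
  apply: ge0_ler_powR => //; rewrite ?nnegrE ?trace_norm_ge0//.
  exact: (le_trans (trace_norm_ge0 _) xi_le).
pose c := l2 * D / (1 + lambda1 * D).
have c_ge0 : 0 <= c.
  apply: divr_ge0; first by apply: mulr_ge0; exact: ltW.
  by rewrite addr_ge0// mulr_ge0// ltW.
have B0E : B 0 = c0 by rewrite /c0 -MD; exact: (bem_mean_init_diffusion P X_bem).
have D_le_tau : D <= tau.
  by rewrite -MD ler_peMl ?ler1n// ltW.
have c_le : c <= l2 * tau.
  rewrite /c ler_pdivrMr; last by rewrite ltr_pwDl// mulr_ge0// ltW.
  apply: (@le_trans _ _ (l2 * tau)); first by rewrite ler_pM2l.
  rewrite ler_peMr//; first by rewrite mulr_ge0// ltW.
  by rewrite lerDl mulr_ge0// ltW.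
have start : A 0 + c * B 0 + b9 / lambda1
    + E * (M%:R * D) * (b11 * r ^+ 2 + b13 * beta) <= K.
  rewrite MD /K lerD2r lerD2r lerD//; first by apply: A_init; clear; lia.
  by rewrite B0E ler_wpM2r// sqr_ge0.
have b10_dom : b11 * E <= b10 - lambda1.
  by rewrite -subr_ge0; exact: ltW.
have b12_dom : b13 * E < b12 by rewrite -subr_gt0.
have mean_bound := delayed_energy_pointwise D_gt0 lambda1_gt0 lamD growth b9_ge0 b11_ge0
  b13_ge0 b10_dom b12_dom A_ge0 B_ge0 Q_ge0 A_init Q_init energy start.
have window := delayed_energy_window D_gt0 lambda1_gt0 lamD growth b9_ge0 b11_ge0
  b13_ge0 b10_dom b12_dom A_ge0 B_ge0 Q_ge0 A_init Q_init energy start.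
have {}fin (k : int) : - M%:Z <= k -> [/\
    finite_mean P (fun w => trace_norm (X k w) ^+ 2),
    finite_mean P (fun w => trace_norm (X k w) `^ (q + 1)) &
    0 <= k -> finite_mean P (fun w => trace_norm (g (X k w) (X (k - M%:Z) w)) ^+ 2)].
  by move=> kM; apply: (fin `|k|%N k kM); clear; lia.
have sup1 : (ereal_sup
       [set 'E_P[fun w =>
               (trace_norm (X i w) ^+ 2
                + (if 0 <= i then
                     l2 * D / (1 + lambda1 * D)
                       * trace_norm (g (X i w) (X (i - M%:Z) w)) ^+ 2
                   else 0))%R]
       | i in [set i : int | (- M%:Z <= i)%R]] <= (K + r ^+ 2)%:E)%E.
  apply: ge_ereal_sup => _ [i /= iM <-].
  have [iX _ iG] := fin i iM.
  rewrite unlock; case: (boolP (0 <= i)) => [i_ge0|i_lt0].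
    have {}iG := iG i_ge0.
    have icG := finite_meanZ c iG.
    have mean_eq := finite_meanE (finite_meanD iX icG).
    rewrite (RintegralD measurableT iX icG) (RintegralZl _ measurableT iG) in mean_eq.
    rewrite [leLHS]mean_eq lee_fin.
    have := mean_bound `|i|%N; rewrite /= gez0_abs//.
    by move=> bound; apply: (le_trans bound); rewrite lerDl sqr_ge0.
  have i0 := finite_mean_cst P 0.
  have mean_eq := finite_meanE (finite_meanD iX i0).
  rewrite (RintegralD measurableT iX i0) mean_cst addr0 in mean_eq.
  rewrite [leLHS]mean_eq lee_fin.
  apply: (@le_trans _ _ (r ^+ 2)); last by rewrite lerDr.
  by apply: A_init => //; rewrite ltW// ltNge.
have sup2 : (ereal_sup
       [set D%:E *
          \sum_(j < M)
             'E_P[fun w =>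
                (trace_norm (X (k - M%:Z + 1 + (j : nat)%:Z) w)
                   `^ (q + 1))%R]
       | k in [set k : int | (0 <= k)%R]] <= C2%:E)%E.
  apply: ge_ereal_sup => _ [k /= k_ge0 <-].
  have EQ (j : 'I_M) : ('E_P[fun w => (trace_norm (X (k - M%:Z + 1 + (j : nat)%:Z) w)
      `^ (q + 1))%R] = (Q (k - M%:Z + 1 + (j : nat)%:Z))%:E)%E.
    have jM : - M%:Z <= k - M%:Z + 1 + (j : nat)%:Z by move: k_ge0; clear; lia.
    have [_ iQ _] := fin _ jM.
    by rewrite unlock; exact: finite_meanE.
  rewrite (eq_bigr _ (fun j _ => EQ j)) sumEFin -EFinM lee_fin /C2 -MD.
  have := window `|k|%N; rewrite gez0_abs//.
apply: (le_trans (leeD sup1 sup2)).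
by rewrite -EFinD lee_fin lerDl.
Qed.
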